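(* Let $0<\varepsilon<1/2$ be fixed, let $\ell=\ell(n)$, $n$ and $m=m(n)$ be integers such that, as $n\to\infty$, $n/\log^4 n+\ell/\log^4\ell=o(m)$, and set $s=m/\ell$ and $t=m/n$. Let $\mathfrak{D}$ be a set of sequences $\mathbf{d}=(\mathbf{s},\mathbf{t})$ of non-negative integers such that $\mathbf{s}=(s_a)_{a\in S}$ and $\mathbf{t}=(t_v)_{v\in T}$ have length $\ell$ and $n$ respectively, and such that $\sum_{a\in S}s_a=\sum_{v\in T}t_v=m\ge 1$ and $$\Delta_S^3\Delta_T^3(n\ell)^{\varepsilon/2}=o(\min\{sm,tm\})$$ uniformly over $\mathfrak{D}$, where $\Delta_S=\Delta_S(\mathbf{d})=\max_{a\in S}s_a$ and $\Delta_T=\Delta_T(\mathbf{d})=\max_{v\in T}t_v$. Either set $\mathcal{G}=\mathcal{G}(\ell,n,m)$ and $\mathcal{B}_m=\mathcal{B}_m(\ell,n)$ (the bipartite case), or set $\mathcal{G}=\vec{\mathcal{G}}(n,m)$ and $\mathcal{B}_m=\vec{\mathcal{B}}_m(n)$ and restrict to $\ell=n$ (the digraph case). Then, uniformly for $\mathbf{d}\in\mathfrak{D}$, $$ \mathbf{P}_{\mathcal{D}(\mathcal{G})}(\mathbf{d})=\mathbf{P}_{\mathcal{B}_m}(\mathbf{d})\,\tilde H(\mathbf{d})\left(1+O\left(\frac{\Delta_S^3\Delta_T^3(n\ell)^{\varepsilon/2}}{m}\Big(\frac1s+\frac1t\Big)+n^{\varepsilon-1/2}+\ell^{\varepsilon-1/2}\right)\right).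 $$
   Context: Asymptotic statements are for $n\to\infty$ (the restrictions on $\ell$ ensure $\ell\to\infty$ too); $\mathfrak{D}$ may depend on $n$. Vertex sets: $S=[\ell]$, $T=[n+\ell]\setminus[\ell]$. A bipartite graph with bipartition $(S,T)$ has degree sequence $(\mathbf{s},\mathbf{t})$ if each $a\in S$ has degree $s_a$ and each $v\in T$ has degree $t_v$; $\mathcal{D}(G)$ denotes the degree sequence of $G$. When $\ell=n$, for $a\in S$ put $a'=a+n\in T$, and for $v\in T$ put $v'=v-n\in S$. Random graphs: $\mathcal{G}(\ell,n,m)$ is a uniformly random bipartite graph with bipartition $(S,T)$ and exactly $m$ edges. For $\ell=n$, $\vec{\mathcal{G}}(n,m)$ is $\mathcal{G}(n,n,m)$ conditioned on having no edge of the form $aa'$ (equivalently, a uniformly random loopless digraph on $n$ vertices with $m$ arcs; $\mathbf{s}$ is the out-degree sequence and $\mathbf{t}$ the in-degree sequence). $\mathcal{D}(\mathcal{G})$ denotes the probability space of degree sequences of the random graph $\mathcal{G}$. Binomial models: $\mathcal{B}_p(\ell,n)$ is the space of vectors of $\ell+n$ independent components, the first $\ell$ distributed as $\mathrm{Bin}(n,p)$ and the last $n$ as $\mathrm{Bin}(\ell,p)$; $\mathcal{B}_m(\ell,n)$ is its restriction to (conditioning on) the event that the sum of the first $\ell$ components and the sum of the last $n$ components both equal $m$. $\vec{\mathcal{B}}_p(n)$ is the space of vectors of $2n$ independent components distributed as $\mathrm{Bin}(n-1,p)$, and $\vec{\mathcal{B}}_m(n)$ is its restriction to the event that the first $n$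 components sum to $m$ and the last $n$ components sum to $m$. Thus, for $\sum s_a=\sum t_v=m$ (independently of $p$), $$\mathbf{P}_{\mathcal{B}_m(\ell,n)}(\mathbf{s},\mathbf{t})=\binom{\ell n}{m}^{-2}\prod_{a\in S}\binom{n}{s_a}\prod_{v\in T}\binom{\ell}{t_v},\qquad \mathbf{P}_{\vec{\mathcal{B}}_m(n)}(\mathbf{s},\mathbf{t})=\binom{n(n-1)}{m}^{-2}\prod_{a\in S}\binom{n-1}{s_a}\prod_{v\in T}\binom{n-1}{t_v}.$$ Correction factor: let $\delta^{\mathrm{di}}$ be $1$ in the digraph case and $0$ in the bipartite case. For $\mathbf{d}=(\mathbf{s},\mathbf{t})$ with $\sum s_a=\sum t_v=m$, let $s=m/\ell$, $t=m/n$, $\mu=m/(n(\ell-\delta^{\mathrm{di}}))$, $\sigma^2(\mathbf{s})=\frac1\ell\sum_{a\in S}(s_a-s)^2$, $\sigma^2(\mathbf{t})=\frac1n\sum_{v\in T}(t_v-t)^2$, and, in the digraph case, $\sigma(\mathbf{s},\mathbf{t})=\frac1n\sum_{a\in S}(s_a-s)(t_{a'}-t)$. Then $$\tilde H(\mathbf{d})=\exp\left(-\frac12\left(1-\frac{\sigma^2(\mathbf{s})}{s(1-\mu)}\right)\left(1-\frac{\sigma^2(\mathbf{t})}{t(1-\mu)}\right)-\frac{\delta^{\mathrm{di}}\sigma(\mathbf{s},\mathbf{t})}{s(1-\mu)}\right),$$ the last term being absent in the bipartite case. *)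

(* Defs.v *)
From HB Require Import structures.
From mathcomp Require Import all_boot all_order all_algebra.
From mathcomp Require Import all_classical all_reals all_analysis.

Set Implicit Arguments.
Unset Strict Implicit.
Unset Printing Implicit Defensive.

Import Order.TTheory GRing.Theory Num.Theory.
Import numFieldNormedType.Exports.

Local Open Scope classical_set_scope.
Local Open Scope ring_scope.

(* A sequence d = (s, t) indexed by (S, T) with |S| = l and |T| = n.  The
   vertex l + v of T is represented by v : 'I_n, so that for l = n the partner
   a' of a \in S is a itself, read in T. *)
Definition degseq (l n : nat) : Type :=
  ({ffun 'I_l -> nat} * {ffun 'I_n -> nat})%type.

Definition sums_to (l n m : nat) (d : degseq l n) : bool :=
  (\sum_(a < l) d.1 a == m)%N && (\sum_(v < n) d.2 v == m)%N.

Definition DeltaS (l n : nat) (d : degseq l n) : nat := (\max_(a < l) d.1 a)%N.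
Definition DeltaT (l n : nat) (d : degseq l n) : nat := (\max_(v < n) d.2 v)%N.

(* A bipartite graph with bipartition (S, T) is its set of edges. *)
Definition bigraph (l n : nat) : Type := {set 'I_l * 'I_n}.

Definition degrees (l n : nat) (G : bigraph l n) : degseq l n :=
  ([ffun a => #|[set v | (a, v) \in G]|],
   [ffun v => #|[set a | (a, v) \in G]|]).

Definition bip_graphs (l n m : nat) : {set bigraph l n} :=
  [set G : {set 'I_l * 'I_n} | #|G| == m].

Definition di_graphs (n m : nat) : {set bigraph n n} :=
  [set G in bip_graphs n n m | [forall a, (a, a) \notin G]].

(* Probability of d under the degree sequence of a uniform element of Gs. *)
Definition prob_degrees (R : realType) (l n : nat) (Gs : {set bigraph l n})
    (d : degseq l n) : R :=
  #|[set G in Gs | degrees G == d]|%:R / #|Gs|%:R.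

(* l + n independent components, the first l distributed as Bin(A, p), the
   last n as Bin(B, p). *)
Definition prob_Bp (R : realType) (l n A B : nat) (p : R) (d : degseq l n) : R :=
  (\prod_(a < l) binomial_pmf A p (d.1 a)) *
  (\prod_(v < n) binomial_pmf B p (d.2 v)).

Definition degseq_of_ord (l n A B : nat)
    (f : {ffun 'I_l -> 'I_A.+1} * {ffun 'I_n -> 'I_B.+1}) : degseq l n :=
  ([ffun a => nat_of_ord (f.1 a)], [ffun v => nat_of_ord (f.2 v)]).

(* Probability that both sums are m; the support of prob_Bp is the finite set
   {0..A}^l * {0..B}^n. *)
Definition prob_Bp_sums (R : realType) (l n A B m : nat) (p : R) : R :=
  \sum_(f : {ffun 'I_l -> 'I_A.+1} * {ffun 'I_n -> 'I_B.+1}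
        | sums_to m (degseq_of_ord f)) prob_Bp A B p (degseq_of_ord f).

Definition prob_Bm (R : realType) (l n A B m : nat) (p : R) (d : degseq l n) : R :=
  if sums_to m d then prob_Bp A B p d / prob_Bp_sums l n A B m p else 0.

Lemma sum_prod_bin (l A m : nat) :
  (\sum_(f : {ffun 'I_l -> 'I_A.+1} | (\sum_(a < l) f a == m)%N)
     \prod_(a < l) 'C(A, f a) = 'C(l * A, m))%N.
Proof.
have H : ((1 + 'X : {poly int}) ^+ (l * A))%R`_m = 'C(l * A, m)%:R.
  rewrite exprDn.
  rewrite coef_sum.
  under eq_bigr => i _ do rewrite expr1n mul1r coefMn coefXn.
  case: (ltnP m (l * A).+1) => hm.
    rewrite (bigD1 (Ordinal hm)) //= eqxx big1 ?addr0 // => i /eqP hi.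
    by rewrite (_ : m == i = false) ?mul0rn //; apply/eqP => e; apply: hi; apply: val_inj.
  rewrite bin_small // big1 // => i _; rewrite (_ : m == i = false) ?mul0rn //.
  apply/eqP => e; by move: (ltn_ord i); rewrite -e ltnNge hm.
apply/eqP; rewrite -(eqr_nat int) -H mulnC exprM -(card_ord l) -prodr_const card_ord.
under [in X in _ == X]eq_bigr => a _ do rewrite exprDn.
rewrite bigA_distr_bigA coef_sum natr_sum big_mkcond /=; apply/eqP/eq_bigr => f _.
under [in X in _ = X]eq_bigr => a _ do rewrite expr1n mul1r -mulr_natr.
rewrite big_split /= -expr_sum.
rewrite -natr_prod -polyC_natr coefMC coefXn eq_sym.
by case: ifP => _; rewrite ?mul1r ?mul0r.
Qed.

Lemma prod_binomial_pmfE (R : realType) (k A m : nat) (p : R) (x : 'I_k -> nat) :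
  (\sum_i x i = m)%N ->
  \prod_(i < k) binomial_pmf A p (x i) =
  p ^+ m * (1 - p) ^+ (k * A - m) * \prod_(i < k) 'C(A, x i)%:R.
Proof.
move=> hm; case: (boolP [forall i, x i <= A]%N) => [/forallP h|]; last first.
  rewrite negb_forall => /existsP[i]; rewrite -ltnNge => hi.
  by rewrite (bigD1 i) //= [X in _ = _ * X](bigD1 i) //= /binomial_pmf bin_small // mulr0n !mul0r mulr0.
rewrite /binomial_pmf.
under eq_bigr => i _ do rewrite -mulr_natr.
rewrite !big_split /= -!expr_sum hm  /unstable.onem; congr (_ * _ ^+ _ * _).
rewrite sumnB; last by move=> i _; exact: h.
by rewrite hm sum_nat_const card_ord.
Qed.

(* In particular prob_Bm does not depend on p. *)
Lemma prob_BmE (R : realType) (l n A B m : nat) (p : R) (d : degseq l n) :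
  0 < p < 1 -> sums_to m d ->
  prob_Bm A B m p d =
  ('C(l * A, m)%:R * 'C(n * B, m)%:R)^-1 *
  (\prod_(a < l) 'C(A, d.1 a)%:R * \prod_(v < n) 'C(B, d.2 v)%:R).
Proof.
move=> /andP[p0 p1] hd; rewrite /prob_Bm hd.
move: (hd) => /andP[/eqP h1 /eqP h2].
pose K : R := p ^+ m * (1 - p) ^+ (l * A - m) * (p ^+ m * (1 - p) ^+ (n * B - m)).
have K0 : K != 0.
  by rewrite /K !mulf_neq0 // expf_neq0 // ?gt_eqF // subr_gt0.
have -> : prob_Bp A B p d =
  K * (\prod_(a < l) 'C(A, d.1 a)%:R * \prod_(v < n) 'C(B, d.2 v)%:R).
  by rewrite /prob_Bp (prod_binomial_pmfE _ _ h1) (prod_binomial_pmfE _ _ h2) /K mulrACA.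
have -> : prob_Bp_sums l n A B m p = K * ('C(l * A, m)%:R * 'C(n * B, m)%:R).
  rewrite -(sum_prod_bin l) -(sum_prod_bin n) !natr_sum big_distrlr /= pair_big /= mulr_sumr /prob_Bp_sums.
  have e (f : {ffun 'I_l -> 'I_A.+1} * {ffun 'I_n -> 'I_B.+1}) :
    sums_to m (degseq_of_ord f) =
     ((\sum_(a < l) f.1 a == m)%N && (\sum_(a < n) f.2 a == m)%N).
    rewrite /sums_to /=.
    rewrite (eq_bigr (fun a => nat_of_ord (f.1 a))); last by move=> i _; rewrite ffunE.
    by rewrite [X in _ && (X == _)](eq_bigr (fun a => nat_of_ord (f.2 a))) // => i _; rewrite ffunE.
  rewrite (eq_bigl _ _ e); apply: eq_bigr => f; rewrite -e => /andP[/eqP g1 /eqP g2].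
  rewrite /prob_Bp (prod_binomial_pmfE _ _ g1) (prod_binomial_pmfE _ _ g2) mulrACA.
  rewrite !natr_prod; congr (_ * (_ * _));
  by apply: eq_bigr => i _ /=; rewrite ffunE.
by rewrite invfM mulrACA mulfV // mul1r mulrC.
Qed.

Definition prob_bip_Bm (R : realType) (l n m : nat) (p : R) (d : degseq l n) : R :=
  prob_Bm n l m p d.

Definition prob_di_Bm (R : realType) (n m : nat) (p : R) (d : degseq n n) : R :=
  prob_Bm n.-1 n.-1 m p d.

Definition variance_about (R : realType) (k : nat) (c : R)
    (x : {ffun 'I_k -> nat}) : R :=
  k%:R^-1 * \sum_(i < k) ((x i)%:R - c) ^+ 2.

Definition Htilde_bip (R : realType) (l n m : nat) (d : degseq l n) : R :=
  let s : R := m%:R / l%:R in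
  let t : R := m%:R / n%:R in
  let mu : R := m%:R / (n%:R * l%:R) in
  expR (- (1 / 2) * (1 - variance_about s d.1 / (s * (1 - mu)))
                  * (1 - variance_about t d.2 / (t * (1 - mu)))).

Definition Htilde_di (R : realType) (n m : nat) (d : degseq n n) : R :=
  let s : R := m%:R / n%:R in
  let t : R := m%:R / n%:R in
  let mu : R := m%:R / (n%:R * (n%:R - 1)) in
  let cov : R := n%:R^-1 * \sum_(a < n) ((d.1 a)%:R - s) * ((d.2 a)%:R - t) in
  expR (- (1 / 2) * (1 - variance_about s d.1 / (s * (1 - mu)))
                  * (1 - variance_about t d.2 / (t * (1 - mu)))
        - cov / (s * (1 - mu))).

(* f(n, d) = o(g(n, d)) as n -> oo, uniformly over d \in D n. *)
Definition uniform_littleo (R : realType) (T : nat -> Type)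
    (D : forall n, set (T n)) (f g : forall n, T n -> R) : Prop :=
  forall e : R, 0 < e ->
    \forall n \near \oo, forall d, D n d -> `|f n d| <= e * `|g n d|.

(* f(n, d) = g(n, d) (1 + O(h(n, d))) as n -> oo, uniformly over d \in D n. *)
Definition uniform_eq_1pO (R : realType) (T : nat -> Type)
    (D : forall n, set (T n)) (f g h : forall n, T n -> R) : Prop :=
  exists C : R, \forall n \near \oo, forall d, D n d ->
    exists2 theta : R, `|theta| <= C * `|h n d|
                     & f n d = g n d * (1 + theta).

Definition Delta_term (R : realType) (eps : R) (l n : nat) (d : degseq l n) : R :=
  (DeltaS d)%:R ^+ 3 * (DeltaT d)%:R ^+ 3 * (n%:R * l%:R) `^ (eps / 2).

Definition admissible (R : realType) (eps : R) (l m : nat -> nat)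
    (D : forall n, set (degseq (l n) n)) : Prop :=
  [/\ (fun n => n%:R / ln n%:R ^+ 4 + (l n)%:R / ln (l n)%:R ^+ 4 : R)
        =o_\oo (fun n => (m n)%:R : R),
      forall n d, D n d -> sums_to (m n) d /\ (1 <= m n)%N
    & uniform_littleo D (fun n d => Delta_term eps d)
        (fun n _ => let s : R := (m n)%:R / (l n)%:R in
                    let t : R := (m n)%:R / n%:R in
                    Num.min (s * (m n)%:R) (t * (m n)%:R)) ].

Arguments admissible {R} eps l m D.

Definition error_term (R : realType) (eps : R) (l n m : nat) (d : degseq l n) : R :=
  let s : R := m%:R / l%:R in
  let t : R := m%:R / n%:R in
  Delta_term eps d / m%:R * (s^-1 + t^-1)
  + n%:R `^ (eps - 1 / 2) + l%:R `^ (eps - 1 / 2).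

(* Main.v *)
Require Import Defs.
From mathcomp Require Import all_boot all_order all_algebra.
From mathcomp Require Import all_classical all_reals all_analysis.
(* After classical_sets, so that set notions and lemmas are those of finset. *)
From mathcomp Require Import fintype finset fingroup perm zify ring lra.

(** In a pairing model a graph with degree sequence (s, t) and labelled edges is
    a pair of words c : [m] -> S, f : [m] -> T with letter counts s and t such
    that f i <> f j whenever c i = c j (and f i <> c i for digraphs).  Fix c and
    impose these constraints on f one at a time.  Composing f with a
    transposition (j x) preserves the letter counts and violates a constraint
    for at most 2 Delta_S (Delta_T + 1) values of x, so this switching shows that
    a new constraint f i <> f j fails with probability
    sum_v t_v (t_v - 1) / m^2, and f i <> v with probability t_v / m, up to
    O(Delta_S Delta_T^2 / m^2).  Multiplying over the at most m Delta_S
    constraints gives the number of graphs up to a factor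
    exp(O(Delta_S^2 Delta_T^2 / m)); expanding the binomial coefficients with the
    same accuracy turns the exponent into that of H tilde.  The claimed error
    term dominates Delta_S^2 Delta_T^2 / m. *)

Set Implicit Arguments.
Unset Strict Implicit.
Unset Printing Implicit Defensive.

Import Order.TTheory GRing.Theory Num.Theory.
Import numFieldNormedType.Exports.

(** * Switchings *)

(** The obstacle is precision. Errors add up over as many as m Delta_S constraints, so each failure
    probability is needed to second order in 1/m. Among the swaps that should create a given
    collision, allowing for all of them being invalid would cost about Delta_T/m per constraint,
    which is too much. The estimate is therefore bootstrapped. Crude switching bounds the
    probability of any single collision by 2 [dT]/m ([collisions_upper]). A swap that ought to
    create the collision but is invalid forces a further coincidence of values. Switching once more
    shows that two coincidences together have probability O([dT]^2/m^2), so such swaps number only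
    O([dS] [dT]^2/m) on average ([sum_bad_swaps]). The same swaps show that the letter at a given
    position is distributed almost as at an average position ([sum_cofiber]). These counts are made
    in [nat] with denominators cleared, so that an empty set of valid words needs no division. *)

Lemma leq_card_exists (I J : finType) (P : pred I) (Q : I -> pred J) :
  #|[set x | [exists z, P z && Q z x]]| <= \sum_(z | P z) #|[set x | Q z x]|.
Proof.
have -> : [set x | [exists z, P z && Q z x]] = \bigcup_(z | P z) [set x | Q z x].
  apply/setP => x; rewrite inE; apply/existsP/bigcupP.
    by move=> [z /andP[Pz Qz]]; exists z => //; rewrite inE.
  by move=> [z Pz]; rewrite inE => Qz; exists z; rewrite Pz.
elim/big_rec2: _ => [|z n A _ le_A]; first by rewrite cards0.
by rewrite (leq_trans (leq_card_setU _ _)) // leq_add2l.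
Qed.

Lemma leq_card_union (I J : finType) (P : pred I) (Q : I -> pred J) a b :
  #|[set z | P z]| <= a -> (forall z, P z -> #|[set x | Q z x]| <= b) ->
  #|[set x | [exists z, P z && Q z x]]| <= a * b.
Proof.
move=> le_a le_b; apply: leq_trans (leq_card_exists _ _) _.
apply: (@leq_trans (\sum_(z | P z) b)); first exact: leq_sum.
by rewrite sum_nat_const leq_mul2r -cardsE le_a orbT.
Qed.

Lemma card_filter_sum (I : finType) (A : {set I}) (P : pred I) :
  #|[set f in A | P f]| = \sum_(f in A) P f.
Proof. by rewrite -sum1dep_card big_mkcondr. Qed.

Section Switching.
Variables X T : finType.
Implicit Types (f : {ffun X -> T}) (y z : X + T) (i j x : X) (t : T -> nat).

(* The letters are adjoined as points carrying themselves, so that [f i <> v]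
   also becomes a constraint between two points. *)
Definition ext_val f y : T := match y with inl i => f i | inr v => v end.

Definition swap j x f : {ffun X -> T} := [ffun i => f (tperm j x i)].

Definition words t : {set {ffun X -> T}} :=
  [set f : {ffun X -> T} | [forall v, #|[set i | f i == v]| == t v]].

Definition valid (K : rel (X + T)) f :=
  [forall y, forall z, K y z ==> (ext_val f y != ext_val f z)].

Definition valid_words t K := [set f in words t | valid K f].

(** The valid words lost when the constraint between y and z is added to K; their proportion is the
    failure probability to be estimated. *)
Definition collisions t K y z :=
  [set f in valid_words t K | ext_val f y == ext_val f z].

Lemma card_fiber t f v : f \in words t -> #|[set i | f i == v]| = t v.
Proof. by rewrite inE => /forallP/(_ v)/eqP. Qed.

Lemma swapK j x : involutive (swap j x).
Proof. by move=> f; apply/ffunP => i; rewrite !ffunE tpermK. Qed.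

Lemma swapl j x f : swap j x f j = f x.
Proof. by rewrite ffunE tpermL. Qed.

Lemma swapr j x f : swap j x f x = f j.
Proof. by rewrite ffunE tpermR. Qed.

Lemma swap_id j f : swap j j f = f.
Proof. by apply/ffunP => i; rewrite ffunE tperm1 perm1. Qed.

Lemma ext_val_swap j x f y :
  y != inl j -> y != inl x -> ext_val (swap j x f) y = ext_val f y.
Proof.
case: y => [i|v] //= ij ix; rewrite ffunE tpermD //.
  by apply: contraNneq ij => ->.
by apply: contraNneq ix => ->.
Qed.

Lemma swap_words t j x f : (swap j x f \in words t) = (f \in words t).
Proof.
rewrite !inE; apply: eq_forallb => v; congr (_ == _).
rewrite -!sum1dep_card [RHS](reindex_inj (@perm_inj _ (tperm j x))).
by apply: eq_bigl => i; rewrite ffunE.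
Qed.

Section Model.
Variables (t : T -> nat) (K : rel (X + T)) (dS dT : nat).
Hypothesis K_sym : symmetric K.
Hypothesis K_deg : forall y, #|[set z | K y z]| <= dS.
(** Strict, because the extended fiber of v also contains the adjoined letter v. *)
Hypothesis t_lt : forall v, t v < dT.
Local Notation Om := (valid_words t K).
Local Notation col := (collisions t K).
Local Notation m := #|X|.
Local Notation D := (2 * (dS * dT)).

Lemma valid_neq f y z : f \in Om -> K y z -> ext_val f y != ext_val f z.
Proof. by rewrite inE => /andP[_ /forallP/(_ y)/forallP/(_ z)/implyP]; apply. Qed.

Lemma valid_words_sub f : f \in Om -> f \in words t.
Proof. by rewrite inE => /andP[]. Qed.

Lemma card_fiber_le f v : f \in Om -> #|[set x | f x == v]| <= dT.
Proof. by move=> /valid_words_sub/(card_fiber v) ->; exact: ltnW. Qed.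

Lemma card_ext_fiber_le f v : f \in Om -> #|[set y | ext_val f y == v]| <= dT.
Proof.
move=> fO; apply: leq_trans (t_lt v).
have -> : [set y | ext_val f y == v] = inr v |: (inl @: [set i | f i == v]).
  apply/setP => -[i|u]; rewrite !inE /=.
    by rewrite mem_imset ?inE // => a b [].
  rewrite (inj_eq (f := inr)); last by move=> a b [].
  by case: (u == v) => //=; apply/esym/negbTE/negP => /imsetP[].
rewrite cardsU1 card_imset; last by move=> a b [].
by rewrite (card_fiber v (valid_words_sub fO)) -add1n leq_add2r leq_b1.
Qed.

(** Only the values at j and x change. Either the letter f x arriving at j meets a neighbour of j,
    or the letter f j arriving at x meets a neighbour of x. A constraint between j and x survives,
    as it only sees its two values exchanged; hence z is not j in the second case. *)
Lemma invalid_swap f j x : f \in Om -> swap j x f \notin Om ->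
  x != j /\
  ([exists z, K (inl j) z && (ext_val f z == f x)] \/
   [exists z, (ext_val f z == f j) && ((z != inl j) && K (inl x) z)]).
Proof.
move=> fO nO; have xj : x != j.
  by apply: contraNneq nO => ->; rewrite swap_id.
split => //; move: nO; rewrite inE swap_words (valid_words_sub fO) /=.
rewrite negb_forall => /existsP[y]; rewrite negb_forall => /existsP[z].
rewrite negb_imply negbK => /andP[Kyz].
have V := valid_neq fO.
have irr u : ~~ K u u by apply/negP => /V; rewrite eqxx.
have nxj : inl x != inl j :> X + T by apply: contraNneq xj => -[->].
have [yj|yj] := eqVneq y (inl j); first subst y.
  have [zj|zj] := eqVneq z (inl j); first by move: Kyz; rewrite zj (negbTE (irr _)).
  have [zx|zx] := eqVneq z (inl x).
    by subst z; rewrite /= swapl swapr eq_sym (negbTE (V _ _ Kyz)).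
  by rewrite (ext_val_swap f zj zx) /= swapl => e; left; apply/existsP; exists z; rewrite Kyz eq_sym.
have [yx|yx] := eqVneq y (inl x); first subst y.
  have [zj|zj] := eqVneq z (inl j).
    by subst z; rewrite /= swapl swapr eq_sym (negbTE (V _ _ Kyz)).
  have [zx|zx] := eqVneq z (inl x); first by move: Kyz; rewrite zx (negbTE (irr _)).
  rewrite (ext_val_swap f zj zx) /= swapr => e; right; apply/existsP; exists z.
  by rewrite Kyz zj eq_sym e.
rewrite (ext_val_swap f yj yx); have [zj|zj] := eqVneq z (inl j).
  subst z; rewrite /= swapl => e; left; apply/existsP; exists y.
  by rewrite K_sym Kyz.
have [zx|zx] := eqVneq z (inl x).
  subst z; rewrite /= swapr => e; right; apply/existsP; exists y.
  by rewrite K_sym Kyz yj e.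
by rewrite (ext_val_swap f zj zx) (negbTE (V _ _ Kyz)).
Qed.

(** In the first case z is one of [dS] neighbours of j and x lies in a fiber; in the second z lies
    in an extended fiber and x is one of [dS] neighbours of z. Each case allows [dS * dT] values of
    x. *)
Lemma card_invalid_swap f j : f \in Om -> #|[set x | swap j x f \notin Om]| <= D.
Proof.
move=> fO; pose B1 := [set x | [exists z, K (inl j) z && (ext_val f z == f x)]].
pose B2 := [set x | [exists z, (ext_val f z == f j) && ((z != inl j) && K (inl x) z)]].
apply: (@leq_trans #|B1 :|: B2|).
  apply/subset_leq_card/subsetP => x; rewrite in_set => /(invalid_swap fO)[_ h].
  by rewrite in_setU 2!in_set; apply/orP.
apply: leq_trans (leq_card_setU _ _) _; rewrite mul2n -addnn leq_add //.
  apply: leq_card_union => [|z _]; first exact: K_deg.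
  rewrite (_ : [set x | _] = [set x | f x == ext_val f z]) ?card_fiber_le //.
  by apply/setP => x; rewrite !inE eq_sym.
rewrite mulnC; apply: (leq_card_union (P := fun z => ext_val f z == f j)
  (Q := fun z x => (z != inl j) && K (inl x) z)) => [|z _]; first exact: card_ext_fiber_le.
apply: leq_trans (K_deg z); rewrite -(card_imset _ (@inl_inj X T)).
apply/subset_leq_card/subsetP => y /imsetP[x]; rewrite inE => /andP[_ xz] ->.
by rewrite inE K_sym.
Qed.

(** For fixed x the swap is an involution, and asking that both f and its image be valid is
    symmetric in the two. *)
Lemma sum_swap (j : X) (h : {ffun X -> T} -> nat) :
  \sum_(f in Om) \sum_(x | swap j x f \in Om) h f =
  \sum_(f in Om) \sum_(x | swap j x f \in Om) h (swap j x f).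
Proof.
rewrite (exchange_big_dep xpredT) //= [RHS](exchange_big_dep xpredT) //=.
apply: eq_bigr => x _; rewrite (reindex_inj (inv_inj (swapK j x))) /=.
by apply: eq_bigl => f; rewrite swapK andbC.
Qed.

Lemma card_valid_swap f j :
  #|[set x | swap j x f \in Om]| + #|[set x | swap j x f \notin Om]| = m.
Proof. by rewrite -[RHS](cardsC [set x | swap j x f \in Om]); congr (_ + #|pred_of_set _|); apply/setP => x; rewrite !inE. Qed.

Lemma switch_count (A : {set {ffun X -> T}}) j : A \subset Om ->
  \sum_(f in A) #|[set x | swap j x f \in Om]| =
  \sum_(f in Om) #|[set x | swap j x f \in A]|.
Proof.
move=> /subsetP AO; have := sum_swap j (fun f => f \in A).
have -> : \sum_(f in Om) \sum_(x | swap j x f \in Om) (f \in A) =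
          \sum_(f in A) #|[set x | swap j x f \in Om]|.
  rewrite [RHS]big_mkcond [LHS]big_mkcond; apply: eq_bigr => f _.
  rewrite sum_nat_cond_const.
  case: (boolP (f \in A)) => [fA|_]; last by rewrite muln0; case: ifP.
  by rewrite (AO _ fA) muln1.
move=> ->; apply: eq_bigr => f fO; rewrite -sum1dep_card [RHS]big_mkcond [LHS]big_mkcond.
apply: eq_bigr => x _; case: ifP => [|xO]; first by case: ifP.
by case: ifP => // /AO; rewrite xO.
Qed.

Lemma switch_upper (A : {set {ffun X -> T}}) j : A \subset Om ->
  #|A| * m <= #|A| * D + \sum_(f in Om) #|[set x | swap j x f \in A]|.
Proof.
move=> AO; rewrite -(switch_count j AO) -!sum_nat_const -big_split /=.
apply: leq_sum => f fA; rewrite -(card_valid_swap f j) addnC leq_add2r.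
by apply: card_invalid_swap; apply: (subsetP AO).
Qed.

Lemma switch_lower (A : {set {ffun X -> T}}) j : A \subset Om ->
  \sum_(f in Om) #|[set x | swap j x f \in A]| <= #|A| * m.
Proof.
move=> AO; rewrite -(switch_count j AO) -sum_nat_const.
by apply: leq_sum => f fA; exact: max_card.
Qed.

Lemma collisions_sub y z : col y z \subset Om.
Proof. by apply/subsetP => f; rewrite inE => /andP[]. Qed.

Lemma collisionsC y z : col y z = col z y.
Proof. by apply/setP => f; rewrite !inE eq_sym. Qed.

Lemma in_collisions f y z : (f \in col y z) = (f \in Om) && (ext_val f y == ext_val f z).
Proof. by rewrite inE. Qed.

Lemma collisions_swap f j x y : y != inl j -> f \in Om -> swap j x f \in col (inl j) y ->
  f x == ext_val f y.
Proof.
move=> yj fO; rewrite in_collisions => /andP[_] /=; rewrite swapl.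
have [->|yx] := eqVneq y (inl x); first by rewrite /= eqxx.
by rewrite ext_val_swap.
Qed.

Hypothesis D_le : 2 * D <= m.
Hypothesis dT0 : 0 < dT.

(** A swap at j leads into the collision only from f x = f y, for at most [dT] values of x, whereas
    each colliding word has at least m - D >= m/2 valid swaps; hence the factor 2. *)
Lemma collisions_upper_inl j y : y != inl j -> #|col (inl j) y| * m <= 2 * dT * #|Om|.
Proof.
move=> yj; have := switch_upper j (collisions_sub (inl j) y).
have : \sum_(f in Om) #|[set x | swap j x f \in col (inl j) y]| <= #|Om| * dT.
  rewrite -sum_nat_const; apply: leq_sum => f fO.
  apply: leq_trans (card_fiber_le (ext_val f y) fO).
  apply/subset_leq_card/subsetP => x; rewrite in_set => h; rewrite in_set.
  exact: collisions_swap h.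
have : 2 * (#|col (inl j) y| * D) <= #|col (inl j) y| * m by rewrite mulnCA leq_mul2l D_le orbT.
lia.
Qed.

Lemma collisions_upper y z : z != y -> #|col y z| * m <= 2 * dT * #|Om|.
Proof.
case: y z => [j|v] [i|u] zy; try exact: collisions_upper_inl.
  by rewrite collisionsC; apply: collisions_upper_inl; rewrite eq_sym.
suff -> : col (inr v) (inr u) = set0 by rewrite cards0.
apply/setP => f; rewrite in_collisions in_set0 /=; apply/negbTE/nandP; right.
by apply: contraNneq zy => ->.
Qed.

(** The double coincidence forced by f x = f y when the swap of j and x fails at a neighbour z of
    x. *)
Definition collisions2 x y z j :=
  [set f in col (inl x) y | ext_val f z == ext_val f (inl j)].

(** Switch at j and classify the w whose swap produces the double coincidence. The case w = x would
    need f z = f x, which K forbids. The case w = y needs f x = f j and accounts for one w. Any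
    other w needs f x = f y and f w = f z, leaving at most [dT] choices. The single collisions are
    then bounded by [collisions_upper]. *)
Lemma card_collisions2_le x y z j :
  K (inl x) z -> x != j -> z != inl j -> y != inl j -> y != inl x ->
  #|collisions2 x y z j| * (m * m) <= 8 * (dT * dT) * #|Om|.
Proof.
move=> Kxz xj zj yj yx; set A := collisions2 x y z j.
have AO : A \subset Om.
  by apply: subset_trans (collisions_sub (inl x) y); apply/subsetP => f; rewrite inE => /andP[].
have up : \sum_(f in Om) #|[set w | swap j w f \in A]| <=
    #|col (inl x) y| * dT + #|col (inl x) (inl j)|.
  rewrite !card_filter_sum big_distrl -big_split /=.
  apply: leq_sum => f fO.
  have sub w : swap j w f \in A ->
      (f x == ext_val f y) && (f w == ext_val f z) || (f x == f j) && (inl w == y).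
    rewrite in_set in_collisions -andbA => /and3P[f'O].
    have [->|wx] := eqVneq w x.
      move=> _; rewrite /= swapl.
      have zx : z != inl x by apply: contraTneq Kxz => ->; apply/negP => /(valid_neq fO); rewrite eqxx.
      by rewrite ext_val_swap // eq_sym (negbTE (valid_neq fO Kxz)).
    have -> : ext_val (swap j w f) (inl x) = f x.
      by rewrite ext_val_swap //; apply: contraNneq wx => -[->].
    have [yw|yw] := eqVneq y (inl w).
      by rewrite yw /= swapr => -> _; rewrite ?eqxx ?orbT.
    rewrite (ext_val_swap f yj) // => ->; rewrite /= swapl.
    have [->|zw] := eqVneq z (inl w); first by rewrite /= eqxx.
    by rewrite ext_val_swap // eq_sym => ->.
  apply: (@leq_trans #|[set w | (f x == ext_val f y) && (f w == ext_val f z)]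
                    :|: [set w | (f x == f j) && (inl w == y)]|).
    by apply/subset_leq_card/subsetP => w; rewrite in_set in_setU 2!in_set => /sub.
  apply: leq_trans (leq_card_setU _ _) _; apply: leq_add.
    case: (f x == _); last by rewrite mul0n leqn0 cards_eq0; apply/eqP/setP => w; rewrite !inE.
    by rewrite mul1n; apply: card_fiber_le.
  rewrite /=; case: (f x == _); last by rewrite leqn0 cards_eq0; apply/eqP/setP => w; rewrite !inE.
  rewrite [nat_of_bool true]/= -(cards1 (if y is inl i then i else j)).
  by apply/subset_leq_card/subsetP => w; rewrite !inE; case: (y) => //= i /eqP[->].
have := switch_upper j AO.
have h1 := collisions_upper yx.
have h2 : #|col (inl x) (inl j)| * m <= 2 * dT * #|Om|.
  by apply: collisions_upper; apply: contraNneq xj => -[->].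
have : 2 * (#|A| * D) <= #|A| * m by rewrite mulnCA leq_mul2l D_le orbT.
move: up; set c1 := #|col _ y|; set c2 := #|col _ (inl j)|; set S := \sum_(f in _) _.
move=> h3 h4 h5.
have h6 : #|A| * m <= 2 * (c1 * dT + c2) by lia.
have h7 : #|A| * m * m <= 2 * (c1 * dT + c2) * m by rewrite leq_mul2r h6 orbT.
have h8 : dT * (c1 * m) <= dT * (2 * dT * #|Om|) by rewrite leq_mul2l h1 orbT.
have h9 : dT * #|Om| <= dT * dT * #|Om| by rewrite leq_mul2r leq_pmull ?orbT.
rewrite mulnA (leq_trans h7) //.
have -> : 2 * (c1 * dT + c2) * m = 2 * (dT * (c1 * m)) + 2 * (c2 * m) by lia.
lia.
Qed.

Definition bad_swaps j y f :=
  #|[set x | [&& inl x != y, f x == ext_val f y & swap j x f \notin Om]]|.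

(** If f x clashes with a neighbour z of j, then z and y collide, and they differ because y is not a
    neighbour of j: [dS] choices of z, probability 2 [dT]/m, [dT] values of x. Otherwise f j clashes
    with a neighbour z of x: m values of x, [dS] choices of z, probability 8 [dT]^2/m^2. The
    constant is 2 + 8. *)
Lemma sum_bad_swaps j y : y != inl j -> ~~ K (inl j) y ->
  (\sum_(f in Om) bad_swaps j y f) * m <= 10 * (dS * (dT * dT)) * #|Om|.
Proof.
move=> yj Kjy; set N := #|Om|.
pose P x z := [&& K (inl x) z, x != j, z != inl j & y != inl x].
have le_bad f : f \in Om -> bad_swaps j y f <=
    (\sum_(z | K (inl j) z) (f \in col z y) * dT) +
    \sum_x \sum_(z | P x z) (f \in collisions2 x y z j).
  move=> fO.
  pose B1 := [set x | [exists z, K (inl j) z && ((f \in col z y) && (f x == ext_val f y))]].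
  pose B2 := [set x | [exists z, P x z && (f \in collisions2 x y z j)]].
  apply: (@leq_trans #|B1 :|: B2|).
    apply/subset_leq_card/subsetP => x; rewrite in_set => /and3P[xy fxy].
    case/(invalid_swap fO) => xj [] /existsP[z].
      move=> /andP[Kz /eqP zx]; rewrite in_setU 2!in_set; apply/orP; left.
      by apply/existsP; exists z; rewrite Kz fxy in_collisions fO zx fxy.
    move=> /and3P[zj z_neq Kz]; rewrite in_setU 2!in_set; apply/orP; right.
    apply/existsP; exists z; rewrite /P Kz xj z_neq eq_sym xy /=.
    by rewrite in_set in_collisions fO /= fxy zj.
  apply: leq_trans (leq_card_setU _ _) _; apply: leq_add.
    apply: leq_trans (leq_card_exists _ _) _; apply: leq_sum => z _.
    case: (f \in col z y); last by rewrite leqn0 cards_eq0; apply/eqP/setP => w; rewrite !inE.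
    by rewrite mul1n; apply: card_fiber_le.
  rewrite -sum1dep_card big_mkcond; apply: leq_sum => x _ /=.
  case: existsP => // -[z /andP[Pz fz]].
  by rewrite (bigD1 z) //= fz.
have m_gt0 : 0 < m by apply/card_gt0P; exists j.
rewrite -(leq_pmul2r m_gt0).
set S := \sum_(f in Om) _.
have {le_bad} : S <= (\sum_(z | K (inl j) z) #|col z y| * dT) +
    \sum_x \sum_(z | P x z) #|collisions2 x y z j|.
  apply: leq_trans (leq_sum _ le_bad) _; rewrite big_split /= leq_add //.
    rewrite exchange_big /=; apply: leq_sum => z _; rewrite -big_distrl leq_mul2r /=.
    by rewrite [X in _ <= X]card_filter_sum leq_sum ?orbT // => f fO; rewrite in_collisions fO.
  rewrite exchange_big /=; apply: leq_sum => x _; rewrite exchange_big /=.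
  apply: leq_sum => z _; rewrite -sum1_card [X in _ <= X]big_mkcond [X in X <= _]big_mkcond.
  by apply: leq_sum => f _; case: ifP => // _; case: ifP.
set S1 := \sum_(z | _) _; set S2 := \sum_x _ => le_S.
have le1 : S1 * m <= dS * (2 * (dT * dT) * N).
  rewrite big_distrl /=; apply: (@leq_trans (\sum_(z | K (inl j) z) (2 * (dT * dT) * N))).
    apply: leq_sum => z Kz.
    have /collisions_upper : y != z by apply: contraNneq Kjy => ->.
    move=> le_c; rewrite (mulnC _ dT) -mulnA; apply: leq_trans (leq_mul (leqnn dT) le_c) _.
    by rewrite -/N !mulnA (mulnC dT 2).
  by rewrite sum_nat_const leq_mul2r -cardsE K_deg orbT.
have le2 : S2 * (m * m) <= m * (dS * (8 * (dT * dT) * N)).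
  have -> : m * (dS * (8 * (dT * dT) * N)) = \sum_(x : X) dS * (8 * (dT * dT) * N).
    by rewrite sum_nat_const.
  rewrite big_distrl /=; apply: leq_sum => x _.
  rewrite big_distrl /=; apply: (@leq_trans (\sum_(z | P x z) (8 * (dT * dT) * N))).
    by apply: leq_sum => z /and4P[Kz xj zj yx]; exact: card_collisions2_le.
  rewrite sum_nat_const leq_mul2r; apply/orP; right; apply: leq_trans (K_deg (inl x)).
  by apply/subset_leq_card/subsetP => z; rewrite in_set => /and4P[].
have le3 : S1 * m * m <= dS * (2 * (dT * dT) * N) * m by rewrite leq_mul2r le1 orbT.
have : S * m * m <= (S1 + S2) * m * m by rewrite -!mulnA leq_mul2r le_S orbT.
rewrite !mulnDl -(mulnA S2); lia.
Qed.

(** Counts the positions whose letter, if brought to j, would make j collide with y. *)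
Definition cofiber y f := #|[set x | (inl x != y) && (f x == ext_val f y)]|.

(** A valid swap with x other than y lands in the collision exactly when f x = f y. In the first
    bound each colliding word misses at most D swaps and gains one from x = y, so the error is at
    most (D + 1) 2 [dT] times the number of valid words. In the second the error is [bad_swaps]. *)
Lemma collisions_cofiber j y : 0 < dS -> y != inl j -> ~~ K (inl j) y ->
  let S := \sum_(f in Om) cofiber y f in
  #|col (inl j) y| * (m * m) <= m * S + 6 * (dS * (dT * dT)) * #|Om| /\
  m * S <= #|col (inl j) y| * (m * m) + 10 * (dS * (dT * dT)) * #|Om|.
Proof.
move=> dS0 yj Kjy S; set c := #|col _ _|; set N := #|Om|.
have swap_col f x : f \in Om -> swap j x f \in Om -> inl x != y ->
    (swap j x f \in col (inl j) y) = (f x == ext_val f y).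
  by move=> fO f'O xy; rewrite in_collisions f'O /= swapl ext_val_swap // eq_sym.
split.
  have up : \sum_(f in Om) #|[set x | swap j x f \in col (inl j) y]| <= S + c.
    rewrite /S /c [X in _ + X]card_filter_sum -big_split /=; apply: leq_sum => f fO.
    pose B := [set x | (inl x == y) && (f j == ext_val f y)].
    apply: (@leq_trans #|[set x | (inl x != y) && (f x == ext_val f y)] :|: B|).
      apply/subset_leq_card/subsetP => x hx; rewrite in_setU 2!in_set.
      have {hx} h : swap j x f \in col (inl j) y by rewrite in_set in hx.
      have f'O := subsetP (collisions_sub _ _) _ h.
      have [xy|xy] := eqVneq (inl x) y; last by rewrite -swap_col // h.
      by move: h; rewrite in_collisions -xy /= swapl swapr eq_sym => /andP[].
    apply: leq_trans (leq_card_setU _ _) _; rewrite leq_add2l /B /=.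
    case: (f j == _); last by rewrite leqn0 cards_eq0; apply/eqP/setP => w; rewrite !inE andbF.
    rewrite [nat_of_bool true]/= -(cards1 (if y is inl i then i else j)).
    by apply/subset_leq_card/subsetP => w; rewrite !inE andbT; case: (y) => //= i /eqP[->].
  have h1 := switch_upper j (collisions_sub (inl j) y).
  have h2 := collisions_upper (y := inl j) yj.
  rewrite -/c -/N in h1 h2.
  have h3 : c * m <= c * D + (S + c) by apply: leq_trans h1 _; rewrite leq_add2l.
  have h4 : c * m * m <= (c * D + (S + c)) * m by rewrite leq_mul2r h3 orbT.
  have h5 : (D + 1) * (c * m) <= (D + 1) * (2 * dT * N) by rewrite leq_mul2l h2 orbT.
  have h6 : dT * N <= dS * (dT * dT) * N.
    by rewrite leq_mul2r mulnA leq_pmull ?orbT // muln_gt0 dS0.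
  have h7 : (D + 1) * (2 * dT * N) = 4 * (dS * (dT * dT) * N) + 2 * (dT * N) by lia.
  have h8 : (c * D + (S + c)) * m = (D + 1) * (c * m) + m * S by lia.
  rewrite mulnA; lia.
have low := switch_lower j (collisions_sub (inl j) y).
have le_S : S <= \sum_(f in Om) #|[set x | swap j x f \in col (inl j) y]| +
                \sum_(f in Om) bad_swaps j y f.
  rewrite -big_split /=; apply: leq_sum => f fO.
  apply: leq_trans (leq_card_setU _ _).
  apply/subset_leq_card/subsetP => x; rewrite in_set => /andP[xy fx].
  rewrite in_setU 2!in_set xy fx /=; case: (boolP (swap j x f \in Om)) => [f'O|]; last by rewrite orbT.
  by rewrite swap_col // fx.
have := sum_bad_swaps yj Kjy.
rewrite -/N; move: le_S low; rewrite -/c.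
set A := \sum_(f in Om) #|_|; set B := \sum_(f in Om) bad_swaps _ _ _ => h1 h2 h3.
have : m * S <= m * (c * m + B) by rewrite leq_mul2l (leq_trans h1) ?leq_add2r ?orbT.
lia.
Qed.

(** The predicted collision probability multiplied by m^2, which makes it a natural number. *)
Definition mean_num y : nat :=
  match y with inl _ => \sum_v t v * (t v).-1 | inr v => m * t v end.

Lemma sum_word_size f : f \in words t -> \sum_v t v = m.
Proof.
move=> fW; rewrite -sum1_card (partition_big f xpredT) //=.
by apply: eq_bigr => v _; rewrite -(card_fiber v fW) -sum1dep_card.
Qed.

Lemma sum_fiber_size f : f \in words t -> \sum_x t (f x) = \sum_v t v * t v.
Proof.
move=> fW; rewrite (partition_big f xpredT) //=; apply: eq_bigr => v _.
rewrite (eq_bigr (fun=> t v)); last by move=> i /eqP ->.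
by rewrite sum_nat_const -(card_fiber v fW) cardsE.
Qed.

(** For a letter v the cofiber always has size t v. For a position i it has size t (f i) - 1, and
    swapping i with every x compares m times the sum of t (f i) with the sum over x of t (f x),
    which is the sum of the t v ^ 2 for every word. The at most D invalid swaps cost at most [dT]
    each. *)
Lemma sum_cofiber y : let S := \sum_(f in Om) cofiber y f in
  m * S <= mean_num y * #|Om| + 2 * (dS * (dT * dT)) * #|Om| /\
  mean_num y * #|Om| <= m * S + 2 * (dS * (dT * dT)) * #|Om|.
Proof.
move=> S; case: y @S => [i|v] S /=; last first.
  have -> : S = #|Om| * t v.
    rewrite -sum_nat_const; apply: eq_bigr => f fO.
    by rewrite -(card_fiber v (valid_words_sub fO)).
  by rewrite mulnCA -mulnA (mulnC #|Om|); split; apply: leq_trans (leq_addr _ _); rewrite ?mulnA // mulnAC.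
set T2 := \sum_v _; set N := #|Om|.
pose U := \sum_(f in Om) t (f i).
have SU : S + N = U.
  rewrite /S /N -sum1_card -big_split /=; apply: eq_bigr => f fO.
  rewrite -(card_fiber (f i) (valid_words_sub fO)) (cardsD1 i) inE eqxx addnC; congr (_ + _).
  by apply: eq_card => x; rewrite !inE.
pose Q := \sum_v t v * t v.
have hQ f : f \in Om -> T2 + m = Q.
  move=> fO; rewrite -(sum_word_size (valid_words_sub fO)) -big_split /=.
  by apply: eq_bigr => v _; case: (t v) => // k /=; rewrite [RHS]mulnS addnC.
have NQ : N * Q = T2 * N + m * N.
  (* That t sums to m is known only from the existence of a word. *)
  rewrite -mulnDl /N; have [->|[f fO]] := set_0Vmem Om; first by rewrite cards0 muln0.
  by rewrite (hQ f fO) mulnC.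
pose V1 := \sum_(f in Om) \sum_(x | swap i x f \in Om) t (f i).
have V1E : V1 = \sum_(f in Om) \sum_(x | swap i x f \in Om) t (f x).
  rewrite /V1 (sum_swap i (fun f => t (f i))); apply: eq_bigr => f _.
  by apply: eq_bigr => x _; rewrite swapl.
have inv_le (f : {ffun X -> T}) (h : X -> nat) : f \in Om -> (forall x, h x <= dT) ->
    \sum_x h x <= \sum_(x | swap i x f \in Om) h x + D * dT.
  move=> fO hT; rewrite (bigID (fun x => swap i x f \in Om)) /= leq_add2l.
  apply: (@leq_trans (\sum_(x | swap i x f \notin Om) dT)); first exact: leq_sum.
  by rewrite sum_nat_const leq_mul2r -cardsE card_invalid_swap ?orbT.
have sub_le (f : {ffun X -> T}) (h : X -> nat) :
    \sum_(x | swap i x f \in Om) h x <= \sum_x h x.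
  by rewrite [X in _ <= X](bigID (fun x => swap i x f \in Om)) /= leq_addr.
have e1 : m * U = \sum_(f in Om) \sum_(x : X) t (f i).
  by rewrite big_distrr /=; apply: eq_bigr => f _; rewrite sum_nat_const.
have e2 : N * Q = \sum_(f in Om) \sum_(x : X) t (f x).
  rewrite -sum_nat_const; apply: eq_bigr => f fO.
  by rewrite (sum_fiber_size (valid_words_sub fO)).
have l1 : V1 <= m * U by rewrite e1; apply: leq_sum => f _; exact: sub_le.
have l2 : V1 <= N * Q by rewrite e2 V1E; apply: leq_sum => f _; exact: sub_le.
have l3 : m * U <= V1 + N * (D * dT).
  rewrite e1 -sum_nat_const -big_split /=; apply: leq_sum => f fO.
  by apply: (inv_le f (fun=> t (f i)) fO) => x; exact: ltnW.
have l4 : N * Q <= V1 + N * (D * dT).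
  rewrite e2 V1E -sum_nat_const -big_split /=; apply: leq_sum => f fO.
  by apply: (inv_le f (fun x => t (f x)) fO) => x; exact: ltnW.
have e3 : N * (D * dT) = 2 * (dS * (dT * dT)) * N by lia.
have e4 : m * U = m * S + m * N by rewrite -SU mulnDr.
rewrite e3 NQ e4 in l1 l2 l3 l4 *.
by move: l1 l2 l3 l4; clear; move: m => M; lia.
Qed.

Lemma card_collisions j y : 0 < dS -> y != inl j -> ~~ K (inl j) y ->
  #|col (inl j) y| * (m * m) <=
     mean_num y * #|Om| + 12 * (dS * (dT * dT)) * #|Om| /\
  mean_num y * #|Om| <=
     #|col (inl j) y| * (m * m) + 12 * (dS * (dT * dT)) * #|Om|.
Proof.
move=> dS0 yj Kjy; have [h1 h2] := collisions_cofiber dS0 yj Kjy.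
have [h3 h4] := sum_cofiber y.
by move: h1 h2 h3 h4; clear; move: m #|Om| => M N; lia.
Qed.
End Model.
End Switching.

Arguments words {X T} t.

(** * Graphs as pairs of words *)

Section WordCount.
Variable T : finType.

(** Letter counts after deleting one v; faithful only when t v > 0, as the subtraction truncates. *)
Definition decr (t : T -> nat) (v : T) : T -> nat := fun u => t u - (v == u).

Definition cons_word m (v : T) (g : {ffun 'I_m -> T}) : {ffun 'I_m.+1 -> T} :=
  [ffun i => if unlift ord0 i is Some k then g k else v].

Lemma cons_word0 m v (g : {ffun 'I_m -> T}) : cons_word v g ord0 = v.
Proof. by rewrite ffunE unlift_none. Qed.

Lemma cons_wordS m v (g : {ffun 'I_m -> T}) k : cons_word v g (lift ord0 k) = g k.
Proof. by rewrite ffunE liftK. Qed.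

Lemma cons_word_inj m v : injective (@cons_word m v).
Proof. by move=> g h gh; apply/ffunP => k; rewrite -(cons_wordS v g) gh cons_wordS. Qed.

Lemma cons_wordK m (f : {ffun 'I_m.+1 -> T}) :
  cons_word (f ord0) [ffun k => f (lift ord0 k)] = f.
Proof. by apply/ffunP => i; rewrite ffunE; case: unliftP => [k ->|->] //; rewrite ffunE. Qed.

Lemma card_fiber_cons m v (g : {ffun 'I_m -> T}) u :
  #|[set i | cons_word v g i == u]| = (v == u) + #|[set k | g k == u]|.
Proof.
rewrite -!sum1dep_card big_mkcond /= big_ord_recl cons_word0 [in RHS]big_mkcond /=.
by congr (_ + _); apply: eq_bigr => k _; rewrite cons_wordS.
Qed.

Lemma cons_word_words m (t : T -> nat) v (g : {ffun 'I_m -> T}) : 0 < t v ->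
  (cons_word v g \in words t) = (g \in words (decr t v)).
Proof.
move=> tv; rewrite !inE; apply: eq_forallb => u; rewrite card_fiber_cons /decr.
by have [<-|_] := eqVneq v u; rewrite /= ?add0n ?subn0 // add1n -[in LHS](prednK tv) eqSS subn1.
Qed.

(** The multinomial coefficient without division. Words starting with v contribute t v * (m - 1)!,
    and the t v sum to m. *)
Lemma card_words m (t : T -> nat) : \sum_v t v = m ->
  #|words (X := 'I_m) t| * \prod_v (t v)`! = m`!.
Proof.
elim: m t => [|m IH] t.
  move/eqP; rewrite sum_nat_eq0 => /forallP /= t0.
  rewrite big1; last by move=> v _; rewrite (eqP (t0 v)).
  rewrite muln1 (_ : words t = setT) ?cardsT ?card_ffun ?card_ord //.
  apply/setP => f; rewrite !inE; apply/forallP => v.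
  by rewrite (eqP (t0 v)) cards_eq0; apply/eqP/setP => -[].
move=> tm.
have split_word v : #|[set f in words (X := 'I_m.+1) t | f ord0 == v]| * \prod_u (t u)`! = t v * m`!.
  have [t0|tv] := posnP (t v).
    rewrite t0 mul0n (_ : [set f in _ | _] = set0) ?cards0 //.
    apply/setP => f; rewrite in_set in_set0; apply/andP => -[fW /eqP f0].
    by move: (card_fiber v fW); rewrite t0 => /eqP; rewrite cards_eq0 => /eqP/setP/(_ ord0); rewrite !inE f0 eqxx.
  have -> : [set f in words t | f ord0 == v] = cons_word v @: words (X := 'I_m) (decr t v).
    apply/setP => f; rewrite in_set; apply/andP/imsetP.
      move=> [fW /eqP f0]; exists [ffun k => f (lift ord0 k)]; last by rewrite -f0 cons_wordK.
      by rewrite -cons_word_words // -f0 cons_wordK.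
    by move=> [g gW ->]; rewrite cons_word_words // cons_word0 eqxx.
  rewrite card_imset; last exact: cons_word_inj.
  have prodE : \prod_u (t u)`! = t v * \prod_u (decr t v u)`!.
    rewrite (bigD1 v) //= [in RHS](bigD1 v) //= /decr eqxx mulnA subn1; congr (_ * _).
      by case: (t v) tv.
    by apply: eq_bigr => u uv; rewrite eq_sym (negbTE uv) subn0.
  rewrite prodE mulnCA IH //.
  have e : \sum_(u | u != v) decr t v u = \sum_(u | u != v) t u.
    by apply: eq_bigr => u uv; rewrite /decr eq_sym (negbTE uv) subn0.
  rewrite (bigD1 v) //= e /decr eqxx subn1.
  by move: tm; rewrite (bigD1 v) //=; case: (t v) tv => // k _; rewrite addSn => -[].
rewrite -sum1_card (partition_big (fun f : {ffun 'I_m.+1 -> T} => f ord0) xpredT) //=.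
rewrite big_distrl /= factS -[X in _ = X * _]tm big_distrl; apply: eq_bigr => v _.
by rewrite sum1dep_card; exact: split_word.
Qed.

Lemma words_neq0 m (t : T -> nat) : \sum_v t v = m -> words (X := 'I_m) t != set0.
Proof.
move=> /card_words h; rewrite -cards_eq0; apply/eqP => h0; move: h.
by rewrite h0 mul0n => /eqP; rewrite eq_sym eqn0Ngt fact_gt0.
Qed.

Lemma words_perm m (t : T -> nat) (f g : {ffun 'I_m -> T}) :
  f \in words t -> g \in words t -> exists s : 'S_m, forall i, f i = g (s i).
Proof.
move=> fW gW; pose tt (h : {ffun 'I_m -> T}) := [tuple h i | i < m].
have cnt h v : h \in words t -> count_mem v (tt h) = t v.
  move=> hW; rewrite -(card_fiber v hW) count_map -size_filter -cardsE cardE.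
  rewrite -filter_predI; congr size; rewrite /enum_mem; apply/eq_filter => i /=.
  by rewrite !inE andbT.
have /tuple_permP[s e] : perm_eq (tt f) (tt g).
  by apply/allP => v _ /=; rewrite !cnt.
exists s => i; have := congr1 (fun q => nth (f i) q i) e.
by rewrite !nth_mktuple tnth_mktuple.
Qed.
End WordCount.

Section Labelling.
Variables (l n m : nat) (Q : pred ('I_l * 'I_n)).
Variables (s : 'I_l -> nat) (t : 'I_n -> nat).
Implicit Types (x : {ffun 'I_m -> 'I_l}) (y : {ffun 'I_m -> 'I_n}).
Implicit Types (xy : {ffun 'I_m -> 'I_l} * {ffun 'I_m -> 'I_n}).

(* Labelling the edges 1..m turns a graph into a pair of words (x, y), the
   i-th edge being (x i, y i). *)
Definition edge_words x y : bool :=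
  injectiveb (fun i => (x i, y i)) && [forall i, Q (x i, y i)].

Definition graphs_of : {set {set 'I_l * 'I_n}} :=
  [set G : {set 'I_l * 'I_n} | [&& #|G| == m, [forall e in G, Q e],
     [forall a, #|[set v | (a, v) \in G]| == s a] &
     [forall v, #|[set a | (a, v) \in G]| == t v]]].

Definition labellings : {set {ffun 'I_m -> 'I_l} * {ffun 'I_m -> 'I_n}} :=
  [set xy | [&& xy.1 \in words s, xy.2 \in words t & edge_words xy.1 xy.2]].

Definition edge_set xy :=
  [set (xy.1 i, xy.2 i) | i in 'I_m].

Lemma card_edge_set xy : injective (fun i => (xy.1 i, xy.2 i)) -> #|edge_set xy| = m.
Proof. by move=> inj; rewrite card_imset // card_ord. Qed.

Lemma edge_set_deg1 xy a : injective (fun i => (xy.1 i, xy.2 i)) ->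
  #|[set v | (a, v) \in edge_set xy]| = #|[set i | xy.1 i == a]|.
Proof.
move=> inj; have -> : [set v | (a, v) \in edge_set xy] = xy.2 @: [set i | xy.1 i == a].
  apply/setP => v; rewrite in_set; apply/imsetP/imsetP => -[i].
    by move=> _ [-> ->]; exists i; rewrite ?inE.
  by rewrite inE => /eqP <- ->; exists i.
rewrite card_in_imset // => i j; rewrite !inE => /eqP ia /eqP ja e.
by apply: inj; rewrite ia ja e.
Qed.

Lemma edge_set_deg2 xy v : injective (fun i => (xy.1 i, xy.2 i)) ->
  #|[set a | (a, v) \in edge_set xy]| = #|[set i | xy.2 i == v]|.
Proof.
move=> inj; have -> : [set a | (a, v) \in edge_set xy] = xy.1 @: [set i | xy.2 i == v].
  apply/setP => a; rewrite in_set; apply/imsetP/imsetP => -[i].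
    by move=> _ [-> ->]; exists i; rewrite ?inE.
  by rewrite inE => /eqP <- ->; exists i.
rewrite card_in_imset // => i j; rewrite !inE => /eqP ia /eqP ja e.
by apply: inj; rewrite ia ja e.
Qed.

Lemma labellings_edge_set xy : injective (fun i => (xy.1 i, xy.2 i)) ->
  (xy \in labellings) = (edge_set xy \in graphs_of).
Proof.
move=> inj; rewrite [in LHS]inE [in RHS]inE card_edge_set // eqxx /= /edge_words.
have -> /= : injectiveb (fun i => (xy.1 i, xy.2 i)) by apply/injectiveP.
have -> : [forall i, Q (xy.1 i, xy.2 i)] = [forall e in edge_set xy, Q e].
  apply/forallP/forall_inP => [h e /imsetP[i _ ->]|h i]; first exact: h.
  by apply: h; apply/imsetP; exists i.
rewrite andbA andbC !inE; congr [&& _, _ & _]; apply: eq_forallb => a.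
  by rewrite edge_set_deg1.
by rewrite edge_set_deg2.
Qed.

(** The labellings with edge set G are the injections of the m labels into the m edges of G. *)
Lemma card_edge_set_fiber (G : {set 'I_l * 'I_n}) : G \in graphs_of ->
  #|[set xy in labellings | edge_set xy == G]| = m`!.
Proof.
move=> GG; have /andP[/eqP Gm _] : (#|G| == m) && true by move: GG; rewrite inE => /andP[->].
pose zip (xy : {ffun 'I_m -> 'I_l} * {ffun 'I_m -> 'I_n}) := [ffun i => (xy.1 i, xy.2 i)].
have zip_inj : injective zip.
  move=> [x1 y1] [x2 y2] /ffunP e; congr (_, _); apply/ffunP => i;
  by move: (e i); rewrite !ffunE => -[].
rewrite -(card_imset _ zip_inj) -ffactnn.
have -> : m ^_ m = #|G| ^_ #|'I_m| by rewrite Gm card_ord.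
rewrite -card_inj_ffuns_on; apply: eq_card => h; rewrite [in RHS]inE.
apply/imsetP/andP => [[xy]|[/ffun_onP hG /injectiveP inj]].
  rewrite inE => /andP[xyL /eqP <-] ->; split.
    by apply/ffun_onP => i; rewrite ffunE; apply/imsetP; exists i.
  move: xyL; rewrite inE => /and3P[_ _ /andP[/injectiveP inj _]].
  by apply/injectiveP => i j; rewrite !ffunE => /inj.
pose xy := ([ffun i => (h i).1], [ffun i => (h i).2]).
have hE i : (xy.1 i, xy.2 i) = h i by rewrite !ffunE -surjective_pairing.
have inj' : injective (fun i => (xy.1 i, xy.2 i)).
  by move=> i j /=; rewrite !hE => /inj.
have EG : edge_set xy = G.
  apply/eqP; rewrite eqEcard card_edge_set // Gm leqnn andbT.
  by apply/subsetP => e /imsetP[i _ ->]; rewrite hE.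
exists xy; last by apply/ffunP => i; rewrite ffunE hE.
by rewrite inE labellings_edge_set // EG GG eqxx.
Qed.

Lemma card_labellings : #|labellings| = #|graphs_of| * m`!.
Proof.
rewrite -sum1_card (partition_big edge_set (mem graphs_of)) /=; last first.
  move=> xy xyL; rewrite -labellings_edge_set //.
  by move: xyL; rewrite inE => /and3P[_ _ /andP[/injectiveP]].
rewrite -sum_nat_const; apply: eq_bigr => G GG.
by rewrite sum1dep_card -(card_edge_set_fiber GG).
Qed.

(** Since x is c with its positions permuted, the same permutation applied to y carries the partners
    of c to those of x. *)
Lemma card_partners x c : x \in words s -> c \in words s ->
  #|[set y in words t | edge_words x y]| = #|[set y in words t | edge_words c y]|.
Proof.
move=> xW cW; have [p xp] := words_perm xW cW.
pose F y : {ffun 'I_m -> 'I_n} := [ffun i => y (p i)].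
have F_inj : injective F.
  by move=> y z /ffunP e; apply/ffunP => i; move: (e (p^-1%g i)); rewrite !ffunE permKV.
rewrite -(card_imset [set y in words t | edge_words c y] F_inj).
have FW y : (F y \in words t) = (y \in words t).
  rewrite !inE; apply: eq_forallb => v; congr (_ == _).
  rewrite -!sum1dep_card [RHS](reindex_inj (@perm_inj _ p)).
  by apply: eq_bigl => i; rewrite ffunE.
have FE y : edge_words x (F y) = edge_words c y.
  rewrite /edge_words; congr (_ && _).
    apply/injectiveP/injectiveP => inj i j.
      move=> e; rewrite -[i](permKV p) -[j](permKV p); congr (p _).
      by apply: inj; rewrite !xp !ffunE !permKV.
    by rewrite !xp !ffunE => /inj/perm_inj.
  apply/forallP/forallP => h i; last by rewrite xp ffunE.
  by have := h (p^-1%g i); rewrite xp ffunE permKV.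
apply: eq_card => y; apply/idP/imsetP => [|[z]].
  move=> yW; have yF : y = F [ffun i => y (p^-1%g i)] by apply/ffunP => i; rewrite !ffunE permK.
  by exists [ffun i => y (p^-1%g i)] => //; rewrite inE -FE -FW -yF; rewrite inE in yW.
by move=> h ->; rewrite in_set FW FE; rewrite in_set in h.
Qed.

(** This is what allows c to be fixed: the m! labellings of each graph cancel against the number m!
    / prod (s a)! of choices of c, all having equally many partners. *)
Lemma card_graphs_of c : c \in words s ->
  #|graphs_of| * \prod_a (s a)`! = #|[set y in words t | edge_words c y]|.
Proof.
move=> cW; set F := #|[set y in words t | _]|.
have sm : \sum_a s a = m by rewrite (sum_word_size cW) card_ord.
have h : #|graphs_of| * m`! = #|words (X := 'I_m) s| * F.
  rewrite -card_labellings -sum_nat_const -sum1_card.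
  rewrite (eq_bigl (fun xy => (xy.1 \in words s) && ((xy.2 \in words t) && edge_words xy.1 xy.2))); last first.
    by move=> xy; rewrite inE.
  rewrite -(pair_big_dep _ (fun x y => (y \in words t) && edge_words x y) (fun _ _ => 1)) /=.
  by apply: eq_bigr => x xW; rewrite sum1dep_card (card_partners xW cW).
have W0 : 0 < #|words (X := 'I_m) s| by apply/card_gt0P; exists c.
apply/eqP; rewrite -(eqn_pmul2l W0) -h mulnCA (card_words sm).
by [].
Qed.
End Labelling.

Local Open Scope ring_scope.

(** * Imposing the constraints one at a time *)

Section Exponentials.
Variable R : realType.
Implicit Types (q x : R).

Lemma ln_1B_bound q : 0 <= q <= 1 / 2 -> `|ln (1 - q) + q| <= 2 * q ^+ 2.
Proof.
move=> /andP[q0 q1]; have p1 : 0 < 1 - q by lra.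
have up : ln (1 - q) <= - q by rewrite -ler_expR lnK ?posrE // expR_ge1Dx.
(* With z = q + 2 q^2, (1 - q) (1 + z) = 1 + q^2 (1 - 2 q) >= 1, so 1 - q >= 1 / (1 + z) >= exp (-
   z). *)
have low : - q - 2 * q ^+ 2 <= ln (1 - q).
  rewrite -ler_expR lnK ?posrE // -opprD expRN.
  have z0 : 0 < 1 + (q + 2 * q ^+ 2) by nra.
  rewrite (@le_trans _ _ (1 + (q + 2 * q ^+ 2))^-1) //.
    by rewrite lef_pV2 ?posrE ?expR_gt0 // expR_ge1Dx.
  by rewrite -[leLHS]mul1r ler_pdivrMr //; nra.
by rewrite ler_norml; apply/andP; split; nra.
Qed.

Lemma prod_1B_expR (I : Type) (r : seq I) (P : pred I) (q : I -> R) :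
  (forall i, P i -> 0 <= q i <= 1 / 2) ->
  exists2 h, `|h| <= 2 * \sum_(i <- r | P i) q i ^+ 2 &
             \prod_(i <- r | P i) (1 - q i) = expR (h - \sum_(i <- r | P i) q i).
Proof.
move=> hq; exists (\sum_(i <- r | P i) (ln (1 - q i) + q i)).
  rewrite mulr_sumr (le_trans (ler_norm_sum _ _ _)) // ler_sum // => i Pi.
  exact: ln_1B_bound (hq i Pi).
rewrite big_split /= addrK expR_sum; apply: eq_bigr => i /hq /andP[_ q1].
by rewrite lnK // posrE; lra.
Qed.

Lemma expRB1_bound x : `|x| <= 1 / 2 -> `|expR x - 1| <= 2 * `|x|.
Proof.
move=> hx; have l1 := expR_ge1Dx x; have l2 := expR_ge1Dx (- x).
have e0 := expR_gt0 x.
have l3 : expR x * (1 - x) <= 1.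
  by rewrite -[leRHS](expRxMexpNx_1 x) ler_wpM2l // ltW.
move: hx; rewrite ler_norml => /andP[x1 x2].
have [x0|x0] := leP 0 x; rewrite ler_norml; apply/andP; split.
- by rewrite ?(ger0_norm x0); lra.
- by rewrite ?(ger0_norm x0); nra.
- by rewrite ?(ltr0_norm x0); lra.
- by rewrite ?(ltr0_norm x0); nra.
Qed.
End Exponentials.

Section ConstraintList.
Variables (R : realType) (X T : finType).
Implicit Types (E : seq (X * (X + T))) (e : X * (X + T)).

Definition constraint E : rel (X + T) := fun y z =>
  has (fun e => (inl e.1 == y) && (e.2 == z) || (inl e.1 == z) && (e.2 == y)) E.

Lemma constraint_sym E : symmetric (constraint E).
Proof. by move=> y z; apply: eq_has => e; rewrite orbC. Qed.

Lemma constraintP E y z : reflect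
  (exists2 e, e \in E & (y = inl e.1 /\ z = e.2) \/ (z = inl e.1 /\ y = e.2))
  (constraint E y z).
Proof.
apply: (iffP hasP) => -[e eE].
  by case/orP => /andP[/eqP <- /eqP <-]; exists e => //; [left|right].
by move=> H; exists e => //; case: H => -[-> ->]; rewrite !eqxx ?orbT.
Qed.

Lemma valid_constraint E (f : {ffun X -> T}) :
  valid (constraint E) f = all (fun e => f e.1 != ext_val f e.2) E.
Proof.
apply/forallP/allP => [h e eE|h y].
  move: (h (inl e.1)) => /forallP/(_ e.2)/implyP; apply.
  by apply/constraintP; exists e => //; left.
apply/forallP => z; apply/implyP => /constraintP[e /h fe [[-> ->]|[-> ->]]] //.
by rewrite eq_sym.
Qed.

Lemma card_valid_cons t e E :
  (#|valid_words t (constraint (e :: E))| +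
   #|collisions t (constraint E) (inl e.1) e.2| = #|valid_words t (constraint E)|)%N.
Proof.
set A := collisions _ _ _ _.
rewrite -(cardsID A (valid_words t (constraint E))) addnC; congr (_ + _)%N.
  by apply: eq_card => f; rewrite in_setI in_set; case: (f \in valid_words _ _).
apply: eq_card => f; rewrite in_setD !in_set.
have -> : valid (constraint (e :: E)) f =
    (ext_val f (inl e.1) != ext_val f e.2) && valid (constraint E) f.
  by rewrite !valid_constraint.
by case: [forall v, _]; case: (valid _ f); case: (_ == _).
Qed.

(** K stands for the full constraint graph: its degree bound passes to every sublist met in the
    induction. The constant 20 is 12 from [card_collisions] plus 8 from replacing 1 - q by exp (-
    q), where q <= 2 [dT]/m. *)
Lemma card_valid_words (t : T -> nat) (K : rel (X + T)) (dS dT : nat) E :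
  symmetric K -> (forall y, #|[set z | K y z]| <= dS)%N ->
  (forall v, t v < dT)%N -> (2 * (2 * (dS * dT)) <= #|X|)%N -> (0 < dS)%N -> (0 < dT)%N ->
  uniq E -> (forall e, e \in E -> K (inl e.1) e.2 /\ e.2 != inl e.1) ->
  (forall e j, e \in E -> e.2 = inl j -> (j, inl e.1) \notin E) ->
  exists2 h : R,
    `|h| <= (size E)%:R * (20 * (dS%:R * dT%:R ^+ 2) / #|X|%:R ^+ 2) &
    #|valid_words t (constraint E)|%:R =
      #|words (X := X) t|%:R *
      expR (h - \sum_(e <- E) (mean_num t e.2)%:R / #|X|%:R ^+ 2).
Proof.
move=> Ksym Kdeg tlt Dle dS0 dT0; elim: E => [|e E IH].
  move=> _ _ _; exists 0; first by rewrite normr0 mul0r.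
  rewrite big_nil subr0 expR0 mulr1; congr (_%:R); apply: eq_card => f.
  by rewrite !inE -/(valid _ f) valid_constraint andbT.
move=> /= /andP[eE uE] EK Erev.
have [h hb hE] : exists2 h : R,
    `|h| <= (size E)%:R * (20 * (dS%:R * dT%:R ^+ 2) / #|X|%:R ^+ 2) &
    #|valid_words t (constraint E)|%:R =
      #|words (X := X) t|%:R *
      expR (h - \sum_(e <- E) (mean_num t e.2)%:R / #|X|%:R ^+ 2).
  apply: IH => // [a aE|a j aE aj]; first by apply: EK; rewrite inE aE orbT.
  have : (j, inl a.1) \notin e :: E by apply: (Erev a) => //; rewrite inE aE orbT.
  by rewrite inE negb_or => /andP[].
set K' := constraint E.
have K'sym : symmetric K' := constraint_sym E.
have K'deg y : (#|[set z | K' y z]| <= dS)%N.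
  apply: leq_trans (Kdeg y); apply/subset_leq_card/subsetP => z; rewrite !in_set.
  case/constraintP => a aE; have [Ka _] : K (inl a.1) a.2 /\ a.2 != inl a.1.
    by apply: EK; rewrite inE aE orbT.
  by case=> -[-> ->] //; rewrite Ksym.
have [Ke ne] := EK e (mem_head _ _).
(* The new pair must not be constrained already, in either orientation: uniqueness excludes e itself
   and [Erev] its reversal. *)
have K'e : ~~ K' (inl e.1) e.2.
  apply/negP => /constraintP[a aE [[[e1] e2]|[e2 e1]]].
    by move: eE; rewrite (surjective_pairing e) e1 e2 -surjective_pairing aE.
  have := Erev e a.1 (mem_head _ _) e2; rewrite inE negb_or => /andP[_].
  by rewrite e1 -surjective_pairing aE.
have [c1 c2] := card_collisions K'sym K'deg tlt Dle dT0 dS0 ne K'e.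
have c3 := collisions_upper K'sym K'deg tlt Dle dT0 ne.
have V := card_valid_cons t e E; rewrite -/K' in V.
set c := #|collisions _ _ _ _| in c1 c2 c3 V.
set N := #|valid_words t K'| in c1 c2 c3 V hE.
set M : R := #|X|%:R.
have M0 : 0 < M by rewrite ltr0n; apply/card_gt0P; exists e.1.
pose r : R := dS%:R * dT%:R ^+ 2 / M ^+ 2.
pose mu : R := (mean_num t e.2)%:R / M ^+ 2.
have dS1 : 1 <= dS%:R :> R by rewrite ler1n.
have dT1 : 1 <= dT%:R :> R by rewrite ler1n.
(* With no valid word left, the induction hypothesis forces [words t] to be empty, as exponentials
   are positive; the old h still works. *)
have [N0|N0] := posnP N.
  have c0 : c = 0%N by move: V; rewrite N0 => /eqP; rewrite addn_eq0 => /andP[_ /eqP].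
  exists h; last first.
    move: V hE; rewrite c0 N0 addn0 => ->; rewrite mulr0n => /esym/eqP.
    by rewrite mulf_eq0 (gt_eqF (expR_gt0 _)) orbF => /eqP ->; rewrite mul0r.
  apply: le_trans hb _; apply: ler_wpM2r; last by rewrite ler_nat.
  by rewrite divr_ge0 ?exprn_ge0 ?mulr_ge0 // exprn_ge0.
have NR : 0 < N%:R :> R by rewrite ltr0n.
pose q : R := c%:R / N%:R.
have q0 : 0 <= q by rewrite divr_ge0.
have qT : q <= 2 * dT%:R / M.
  rewrite ler_pdivrMr // mulrAC ler_pdivlMr // /M -!natrM ler_nat.
  exact: c3.
have TM : 4 * dT%:R <= M.
  rewrite -natrM ler_nat; apply: leq_trans Dle; rewrite mulnA leq_mul2l /=.
  by rewrite leq_pmull.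
have qh : q <= 1 / 2 by apply: le_trans qT _; rewrite ler_pdivrMr //; clear -TM; lra.
have := ln_1B_bound (introT andP (conj q0 qh)); set eta := ln _ + q => eta_b.
have q1 : 0 < 1 - q by clear -qh; lra.
have q2 : q ^+ 2 <= 4 * r.
  apply: (@le_trans _ _ ((2 * dT%:R / M) ^+ 2)); first by rewrite ler_sqr ?nnegrE // (le_trans q0).
  have -> : 4 * r = 4 * (dS%:R * dT%:R ^+ 2) / M ^+ 2 by rewrite /r; ring.
  rewrite expr_div_n exprMn ler_pM2r ?invr_gt0 ?exprn_gt0 //.
  have : 0 <= (dS%:R - 1) * dT%:R ^+ 2 :> R by rewrite mulr_ge0 ?exprn_ge0 ?subr_ge0.
  by clear; lra.
have qm : `|q - mu| <= 12 * r.
  have e1 : q - mu = (c%:R * M ^+ 2 - (mean_num t e.2)%:R * N%:R) / (N%:R * M ^+ 2).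
    by rewrite /q /mu; field; rewrite !gt_eqF.
  have e2 : 12 * r = (12 * (dS%:R * dT%:R ^+ 2) * N%:R) / (N%:R * M ^+ 2).
    by rewrite /r; field; rewrite !gt_eqF.
  have P0 : 0 < N%:R * M ^+ 2 by rewrite mulr_gt0 ?exprn_gt0.
  rewrite e1 e2 normrM (gtr0_norm (_ : 0 < (N%:R * M ^+ 2)^-1)) ?invr_gt0 //.
  rewrite ler_pM2r ?invr_gt0 //.
  move: c1 c2; rewrite -!(ler_nat R) !(natrD, natrM) -/M => c1 c2.
  by clear -c1 c2; rewrite ler_norml; apply/andP; split; lra.
exists (h + (eta - (q - mu))).
  rewrite (le_trans (ler_normD _ _)) // -/M.
  have -> : (size E).+1%:R * (20 * (dS%:R * dT%:R ^+ 2) / M ^+ 2) =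
            (size E)%:R * (20 * (dS%:R * dT%:R ^+ 2) / M ^+ 2) + 20 * r.
    by rewrite -natr1 /r; ring.
  by rewrite lerD // (le_trans (ler_normB _ _)) //; clear -eta_b q2 qm; lra.
have -> : #|valid_words t (constraint (e :: E))|%:R = N%:R * (1 - q) :> R.
  have qN : N%:R * q = c%:R by rewrite /q mulrCA mulfV ?mulr1 // gt_eqF.
  by rewrite mulrBr mulr1 qN -V natrD addrK.
rewrite hE -mulrA; congr (_ * _).
have -> : 1 - q = expR (eta - q) by rewrite /eta addrK lnK.
by rewrite -expRD big_cons -/M -/mu; congr expR; ring.
Qed.
End ConstraintList.

(** * The constraints of a simple graph *)

Section SimpleGraphs.
Local Open Scope nat_scope.
(* [U a = Some v] forbids the edge av: [U] is [fun=> None] for bipartite graphs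
   and [Some] for digraphs. *)
Variables (l n m : nat) (U : 'I_l -> option 'I_n).
Variables (s : 'I_l -> nat) (t : 'I_n -> nat) (c : {ffun 'I_m -> 'I_l}).
Hypothesis U_inj : forall a b v, U a = Some v -> U b = Some v -> a = b.
Hypothesis cW : c \in words s.
Variable dS : nat.
Hypothesis s_le : forall a, s a <= dS.

(** The order on positions lists each pair of edges at a common vertex of S once, so that no
    constraint appears with its reversal. *)
Definition cell_pairs : {set 'I_m * 'I_m} :=
  [set e : 'I_m * 'I_m | (e.1 < e.2) && (c e.1 == c e.2)].

Definition forbidden_values : seq ('I_m * ('I_m + 'I_n)) :=
  pmap (fun i => omap (fun v => (i, inr v)) (U (c i))) (enum 'I_m).

Definition simple_constraints : seq ('I_m * ('I_m + 'I_n)) :=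
  [seq (e.1, inl e.2) | e <- enum cell_pairs] ++ forbidden_values.

Definition conflict : rel ('I_m + 'I_n) := fun y z =>
  match y, z with
  | inl i, inl j => (i != j) && (c i == c j)
  | inl i, inr v | inr v, inl i => U (c i) == Some v
  | inr _, inr _ => false
  end.

Definition partner_deg (a : 'I_l) : nat := if U a is Some v then t v else 0.

Lemma mem_cell_constraints (e : 'I_m * ('I_m + 'I_n)) :
  (e \in [seq (e.1, inl e.2) | e <- enum cell_pairs]) =
  (if e.2 is inl j then (e.1 < j) && (c e.1 == c j) else false).
Proof.
apply/mapP/idP => [[[i j]]|].
  by rewrite mem_enum inE => h ->.
case: e => i [j|v] //= h; exists (i, j) => //; by rewrite mem_enum inE.
Qed.

Lemma mem_forbidden_values e : (e \in forbidden_values) =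
  (if e.2 is inr v then U (c e.1) == Some v else false).
Proof.
rewrite mem_pmap; apply/mapP/idP => [[i _]|].
  by case Ui: (U (c i)) => [v|] //= [->] /=; rewrite Ui.
by case: e => i [j|v] //= /eqP Ui; exists i; rewrite ?mem_enum // Ui.
Qed.

Lemma uniq_simple_constraints : uniq simple_constraints.
Proof.
rewrite cat_uniq map_inj_uniq ?enum_uniq /=; last by move=> [i j] [i' j'] [-> ->].
apply/andP; split.
  by apply/hasPn => e; rewrite mem_forbidden_values mem_cell_constraints; case: e.2.
apply: (pmap_uniq (g := fst)); last exact: enum_uniq.
by move=> i /=; case: (U (c i)).
Qed.

Lemma simple_constraints_conflict e : e \in simple_constraints ->
  conflict (inl e.1) e.2 /\ e.2 != inl e.1.
Proof.
rewrite mem_cat mem_cell_constraints mem_forbidden_values.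
case: e => i [j|v] /=; rewrite ?orbF //.
move=> /andP[ij ->]; have ne : i != j by apply: contraTneq ij => ->; rewrite ltnn.
by rewrite ne andbT; split => //; rewrite eq_sym; apply: contraNneq ne => -[->].
Qed.

Lemma simple_constraints_rev e j : e \in simple_constraints -> e.2 = inl j ->
  (j, inl e.1) \notin simple_constraints.
Proof.
rewrite !mem_cat !mem_cell_constraints !mem_forbidden_values; case: e => i [k|v] //=.
by rewrite !orbF => /andP[ij _] [<-]; rewrite negb_and -leqNgt (ltnW ij).
Qed.

Lemma conflict_sym : symmetric conflict.
Proof. by move=> [i|u] [j|v] //=; rewrite eq_sym [c i == _]eq_sym. Qed.

(** A position i has s (c i) - 1 neighbours in its cell and at most one forbidden letter, which
    takes the place of i in the count. A letter is forbidden on at most one cell, by injectivity of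
    U. *)
Lemma conflict_deg y : #|[set z | conflict y z]| <= dS.
Proof.
case: y => [i|v].
  pose A := [set inl j | j in [set j | c j == c i] :\ i] : {set 'I_m + 'I_n}.
  pose B : {set 'I_m + 'I_n} := if U (c i) is Some v then [set inr v] else set0.
  apply: (@leq_trans #|A :|: B|).
    apply/subset_leq_card/subsetP => -[j|v]; rewrite !inE /=.
      move=> /andP[ij cij]; apply/orP; left; apply/imsetP; exists j => //.
      by rewrite !inE eq_sym ij eq_sym.
    by move=> /eqP ui; apply/orP; right; rewrite /B ui inE.
  apply: leq_trans (leq_card_setU _ _) _; apply: leq_trans (s_le (c i)).
  rewrite -(card_fiber (c i) cW) (cardsD1 i) inE eqxx card_imset; last by move=> a b [].
  by rewrite addnC leq_add2r /B; case: (U (c i)) => [v|]; rewrite ?cards1 ?cards0.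
case: (pickP (fun a => U a == Some v)) => [a /eqP Ua|nU].
  apply: leq_trans (s_le a); rewrite -(card_fiber a cW) -(card_imset _ (@inl_inj 'I_m 'I_n)).
  apply/subset_leq_card/subsetP => -[j|u]; rewrite !inE //= => /eqP Uj.
  by apply/imsetP; exists j; rewrite // inE (U_inj Ua Uj).
rewrite (_ : [set z | _] = set0) ?cards0 //.
by apply/setP => -[j|u]; rewrite !inE //= nU.
Qed.

Lemma edge_words_constraints (y : {ffun 'I_m -> 'I_n}) :
  edge_words (fun e => U e.1 != Some e.2) c y =
  all (fun e => y e.1 != ext_val y e.2) simple_constraints.
Proof.
rewrite all_cat /edge_words; congr (_ && _).
  apply/injectiveP/allP => [inj [i z]|h i j [cij yij]].
    rewrite mem_cell_constraints /=; case: z => //= j /andP[ij /eqP cij].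
    apply: contraTneq ij => yij; rewrite (inj i j) ?ltnn //.
    by rewrite cij yij.
  apply/eqP; apply: contraT; rewrite neq_ltn => /orP[] lt.
    by have := h (i, inl j); rewrite mem_cell_constraints /= lt cij yij !eqxx => /(_ isT).
  by have := h (j, inl i); rewrite mem_cell_constraints /= lt cij yij !eqxx => /(_ isT).
apply/forallP/allP => [h [i z]|h i].
  rewrite mem_forbidden_values /=; case: z => //= v /eqP Ui.
  by apply: contraNneq (h i) => /= ->; rewrite Ui.
apply/negP => /= Ui; have := h (i, inr (y i)).
by rewrite mem_forbidden_values /= Ui eqxx => /(_ isT).
Qed.

Lemma sum_cells (F : 'I_l -> nat) : \sum_i F (c i) = \sum_a s a * F a.
Proof.
rewrite (partition_big c xpredT) //=; apply: eq_bigr => a _.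
rewrite (eq_bigr (fun=> F a)); last by move=> i /eqP ->.
by rewrite sum_nat_const -(card_fiber a cW) cardsE.
Qed.

Lemma card_cell_pairs : 2 * #|cell_pairs| = \sum_a s a * (s a).-1.
Proof.
rewrite -(sum_cells (fun a => (s a).-1)).
pose P2 := [set e : 'I_m * 'I_m | (e.2 < e.1) && (c e.1 == c e.2)].
have e2 : #|P2| = #|cell_pairs|.
  have g_inj : injective (fun e : 'I_m * 'I_m => (e.2, e.1)) by move=> [i j] [i' j'] [-> ->].
  rewrite -(card_imset cell_pairs g_inj); apply: eq_card => -[i j]; rewrite [LHS]in_set /=.
  apply/idP/imsetP => [h|[[i' j']]]; first by exists (j, i); rewrite // inE /= eq_sym.
  by rewrite inE /= => h [-> ->]; rewrite eq_sym.
rewrite mul2n -addnn -[in X in _ + X]e2.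
have -> : #|cell_pairs| + #|P2| = #|[set e : 'I_m * 'I_m | (e.1 != e.2) && (c e.1 == c e.2)]|.
  rewrite -cardsUI (_ : cell_pairs :&: P2 = set0) ?cards0 ?addn0.
    apply: eq_card => e; rewrite !inE -andb_orl -neq_ltn.
    by [].
  apply/setP => e; rewrite !inE; apply/negP => /andP[/andP[h1 _] /andP[h2 _]].
  by move: (ltn_trans h1 h2); rewrite ltnn.
rewrite -sum1dep_card -(pair_big_dep xpredT (fun i j => (i != j) && (c i == c j)) (fun _ _ => 1)) /=.
apply: eq_bigr => i _; rewrite sum1dep_card -(card_fiber (c i) cW) (cardsD1 i [set j | c j == c i]).
rewrite inE eqxx /=; apply: eq_card => j; rewrite !inE eq_sym; congr (_ && _).
by rewrite eq_sym.
Qed.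
End SimpleGraphs.

Lemma card_simple_graphs (R : realType) l n m (U : 'I_l -> option 'I_n)
    (s : 'I_l -> nat) (t : 'I_n -> nat) (a b : nat) :
  (forall i j v, U i = Some v -> U j = Some v -> i = j) ->
  (\sum_i s i = m)%N -> (\sum_v t v = m)%N ->
  (forall i, s i <= a)%N -> (forall v, t v <= b)%N ->
  (0 < a)%N -> (0 < b)%N -> (8 * (a * b) <= m)%N ->
  exists2 h : R, `|h| <= 80 * (a%:R ^+ 2 * b%:R ^+ 2 / m%:R) &
    #|graphs_of m (fun e => U e.1 != Some e.2) s t|%:R *
      (\prod_i (s i)`!%:R * \prod_v (t v)`!%:R) =
    m`!%:R * expR (h
      - (\sum_i s i * (s i).-1)%:R * (\sum_v t v * (t v).-1)%:R / (2 * m%:R ^+ 2)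
      - (\sum_i s i * partner_deg U t i)%:R / m%:R).
Proof.
move=> Uinj sm tm sa tb a0 b0 abm.
have [c cW] : exists c, c \in words (X := 'I_m) s.
  by have /set0Pn := words_neq0 sm.
have m0 : (0 < m)%N by apply: leq_trans abm; rewrite !muln_gt0 a0.
pose E := simple_constraints U c.
(* The bound [dT] is b + 1 because the switching estimates ask for t v < [dT]. *)
have abm' : (2 * (2 * (a * b.+1)) <= #|'I_m|)%N.
  rewrite card_ord mulnS; have : (a <= a * b)%N by rewrite leq_pmulr.
  by move: abm; clear; lia.
have [h hb hE] := @card_valid_words R _ _ t (conflict U c) a b.+1 E
  (@conflict_sym _ _ _ U c) (conflict_deg Uinj cW sa) (fun v => tb v) abm' a0 (ltn0Sn b)
  (uniq_simple_constraints U c) (@simple_constraints_conflict _ _ _ U c)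
  (@simple_constraints_rev _ _ _ U c).
rewrite card_ord in hb hE.
have size_E : (size E = #|cell_pairs c| + size (forbidden_values U c))%N.
  by rewrite size_cat size_map -cardE.
have cells2 := card_cell_pairs cW.
have cells_le : (\sum_i s i * (s i).-1 <= m * a.-1)%N.
  rewrite -sm big_distrl leq_sum // => i _; rewrite leq_mul2l.
  by rewrite -!subn1 leq_sub2r ?orbT.
(* There are at most m (a - 1) / 2 cell pairs and m forbidden values. With an error of 20 a (b +
   1)^2 / m^2 for each and b + 1 <= 2 b, the total is 80 a^2 b^2 / m. *)
have size_le : (size E <= m * a)%N.
  have : (size (forbidden_values U c) <= m)%N.
    by rewrite size_pmap (leq_trans (count_size _ _)) // size_enum_ord.
  move: cells_le; rewrite -cells2 size_E; case: (a) a0 => // a' _ /=.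
  rewrite mulnS; have : (0 <= m * a')%N by []; lia.
have mR : 0 < m%:R :> R by rewrite ltr0n.
exists h.
  apply: le_trans hb _.
  have -> : 80 * (a%:R ^+ 2 * b%:R ^+ 2 / m%:R) =
    (m * a)%:R * (20 * (a%:R * (2 * b%:R) ^+ 2) / m%:R ^+ 2) :> R.
    by rewrite natrM; field; rewrite gt_eqF.
  apply: ler_pM => //; rewrite ?ler_nat //.
  rewrite ler_pM2r ?invr_gt0 ?exprn_gt0 // ler_pM2l // ler_wpM2l // lerXn2r ?nnegrE ?mulr_ge0 //.
  by rewrite -natrM ler_nat mul2n -addnn -addn1 leq_add2l.
have card_y : #|[set y in words t | edge_words (fun e => U e.1 != Some e.2) c y]| =
              #|valid_words t (constraint E)|.
  by apply: eq_card => y; rewrite !in_set edge_words_constraints valid_constraint.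
have := card_graphs_of (fun e => U e.1 != Some e.2) t cW.
rewrite card_y => /(congr1 (fun k => k%:R : R)); rewrite natrM natr_prod hE => gE.
rewrite mulrA gE mulrAC -natr_prod -[X in X * expR _ = _]natrM (card_words tm); congr (_ * expR _).
rewrite -addrA; congr (_ + _); rewrite -opprD; congr (- _).
rewrite big_cat /= big_map big_enum /= sumr_const; congr (_ + _).
  by rewrite -cells2 natrM -[LHS]mulr_natr; field; rewrite gt_eqF.
have -> : \sum_(e <- forbidden_values U c) (mean_num t e.2)%:R / m%:R ^+ 2 =
          \sum_(e <- forbidden_values U c) (if e.2 is inr v then t v else 0)%:R / m%:R :> R.
  apply: eq_big_seq => -[i [j|v]]; rewrite mem_forbidden_values //= => _.
  by rewrite card_ord natrM; field; rewrite gt_eqF.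
rewrite -mulr_suml -(sum_cells cW) natr_sum; congr (_ / _).
rewrite /forbidden_values /partner_deg -[RHS]big_enum /=.
elim: (enum _) => [|i r IH] /=; first by rewrite !big_nil.
by rewrite big_cons -IH; case: (U (c i)) => [v|] /=; rewrite ?big_cons ?add0r.
Qed.

(** * Falling factorials to second order *)

Section FallingFactorial.
Variable R : realType.

Lemma sum_ord_natr k : \sum_(i < k) i%:R = (k * k.-1)%:R / 2 :> R.
Proof.
elim: k => [|k IH]; first by rewrite big_ord0 mul0r.
rewrite big_ord_recr /= IH; case: k {IH} => [|k] /=; first by rewrite muln0 mul0r addr0.
by rewrite !natrM -!natr1; field.
Qed.

(** Write the falling factorial as A^k times the product of the 1 - i/A for i < k. The linear terms
    sum to k (k - 1) / (2 A), and the squares to at most k^3 / A^2. *)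
Lemma ffact_expR (A k : nat) : (2 * k <= A)%N -> (0 < A)%N ->
  exists2 h : R, `|h| <= 2 * (k%:R * k%:R ^+ 2 / A%:R ^+ 2) &
    (A ^_ k)%:R = A%:R ^+ k * expR (h - (k * k.-1)%:R / (2 * A%:R)).
Proof.
move=> kA A0; have AR : 0 < A%:R :> R by rewrite ltr0n.
have [i _|h hb hE] := @prod_1B_expR R _ (index_enum 'I_k) xpredT (fun i => i%:R / A%:R).
  rewrite divr_ge0 //= ler_pdivrMr //.
  have : (2 * i)%:R <= A%:R :> R.
    by rewrite ler_nat; apply: leq_trans kA; rewrite leq_mul2l (ltnW (ltn_ord i)) orbT.
  by rewrite natrM; lra.
exists h.
  apply: le_trans hb _; rewrite ler_pM2l //.
  rewrite (@le_trans _ _ (\sum_(i < k) k%:R ^+ 2 / A%:R ^+ 2)) //.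
    apply: ler_sum => i _; rewrite expr_div_n ler_pM2r ?invr_gt0 ?exprn_gt0 //.
    by rewrite lerXn2r ?nnegrE // ler_nat (ltnW (ltn_ord i)).
  by rewrite sumr_const card_ord -[leLHS]mulr_natl mulrA.
rewrite ffact_prod natr_prod.
have -> : \prod_(i < k) (A - i)%:R = \prod_(i < k) (A%:R * (1 - i%:R / A%:R)) :> R.
  apply: eq_bigr => i _; rewrite natrB; last first.
    by rewrite (leq_trans (ltnW (ltn_ord i))) // (leq_trans _ kA) // leq_pmull.
  by rewrite mulrBr mulr1 mulrCA mulfV ?mulr1 // gt_eqF.
rewrite big_split /= hE prodr_const card_ord -mulr_suml sum_ord_natr.
by congr (_ * expR (_ - _)); field; rewrite gt_eqF.
Qed.

Lemma prod_ffact_expR (l m A a : nat) (s : 'I_l -> nat) :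
  (\sum_i s i = m)%N -> (forall i, s i <= a)%N -> (2 * a <= A)%N -> (0 < A)%N ->
  exists2 h : R, `|h| <= 2 * (m%:R * a%:R ^+ 2 / A%:R ^+ 2) &
    \prod_i (A ^_ (s i))%:R =
      A%:R ^+ m * expR (h - (\sum_i s i * (s i).-1)%:R / (2 * A%:R)).
Proof.
move=> sm sa aA A0; have AR : 0 < A%:R :> R by rewrite ltr0n.
have : forall i, exists h : R, `|h| <= 2 * ((s i)%:R * a%:R ^+ 2 / A%:R ^+ 2) /\
    (A ^_ (s i))%:R = A%:R ^+ (s i) * expR (h - (s i * (s i).-1)%:R / (2 * A%:R)).
  move=> i; have sA : (2 * s i <= A)%N by apply: leq_trans aA; rewrite leq_mul2l sa orbT.
  have [h hb hE] := ffact_expR sA A0; exists h; split => //.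
  apply: le_trans hb _; rewrite ler_pM2l // ler_pM2r ?invr_gt0 ?exprn_gt0 //.
  by rewrite ler_wpM2l // lerXn2r ?nnegrE // ler_nat.
move=> /choice[h hP]; exists (\sum_i h i).
  rewrite (le_trans (ler_norm_sum _ _ _)) // -sm natr_sum !mulr_suml mulr_sumr.
  by apply: ler_sum => i _; have [] := hP i.
rewrite (eq_bigr _ (fun i _ => proj2 (hP i))) big_split /= -expr_sum.
by rewrite sm -expR_sum sumrB natr_sum -mulr_suml.
Qed.
End FallingFactorial.

(** * Comparison of the exponents *)

Section Exponent.
Variable R : realType.
Implicit Types (a b d e h l n u v w x y : R).

(** With k = 1 + w, the factor 1 - (1 + u) k of the exponent of H tilde equals - (u + w (1 + u)).
    The lemma bounds the cost of replacing k by 1 in the product of two such factors. *)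
Lemma perturbed_product u v a b w :
  `|u| <= a -> `|v| <= b -> 1 <= a -> 1 <= b -> 0 <= w <= 1 ->
  `|(u + w * (1 + u)) * (v + w * (1 + v)) - u * v| <= 8 * (a * b) * w.
Proof.
move=> ua vb a1 b1 /andP[w0 w1].
have -> : (u + w * (1 + u)) * (v + w * (1 + v)) - u * v =
  (u * (1 + v) + v * (1 + u) + w * ((1 + u) * (1 + v))) * w by ring.
rewrite normrM (ger0_norm w0) ler_wpM2r //.
have u1 : `|1 + u| <= 2 * a by apply: le_trans (ler_normD _ _) _; rewrite normr1; lra.
have v1 : `|1 + v| <= 2 * b by apply: le_trans (ler_normD _ _) _; rewrite normr1; lra.
have h1 : `|u * (1 + v)| <= a * (2 * b) by rewrite normrM ler_pM.
have h2 : `|v * (1 + u)| <= b * (2 * a) by rewrite normrM ler_pM.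
have h3 : `|w * ((1 + u) * (1 + v))| <= 1 * ((2 * a) * (2 * b)).
  by rewrite !normrM ler_pM ?mulr_ge0 // ?ler_pM // ger0_norm.
apply: le_trans (ler_normD _ _) _; apply: le_trans (lerD (ler_normD _ _) (lexx _)) _.
have := lerD (lerD h1 h2) h3; lra.
Qed.

(* The logarithm of P(d) under the random graph over P(d) under the binomial
   model, up to vanishing terms: S2 = sum s_a (s_a - 1), T2 = sum t_v (t_v - 1),
   Lam = sum s_a t_a', d = delta^di, A = n - d, B = l - d, L = l A = n B. *)
Definition log_ratio (m l n A B L S2 T2 Lam d : R) : R :=
  - (S2 * T2) / (2 * m ^+ 2) - d * Lam / m - m * (m - 1) / (2 * L)
  + S2 / (2 * A) + T2 / (2 * B) + d * m / l.

(** The exponent of H tilde in the same variables: sigma^2(s) / s = 1 + S2 / m - m / l, similarly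
    for t, and sigma(s, t) / s = Lam / m - m / n. *)
Definition log_Htilde (m l n L S2 T2 Lam d : R) : R :=
  let k := (1 - m / L)^-1 in
  - (1 / 2) * (1 - (1 + S2 / m - m / l) * k) * (1 - (1 + T2 / m - m / n) * k)
  - d * (Lam / m - m / n) * k.

(** Both quantities are close to - u v / 2 - d (Lam / m - y), where u = S2 / m - x and v = T2 / m -
    y. In [log_Htilde] the error comes from k = 1 + w with w = O(a b / m). In [log_ratio] the
    quadratic terms combine into u v, the term d m / l supplies d y, and the error comes from 1 / A
    - 1 / n, 1 / B - 1 / l and m (m - 1) against m^2. *)
Lemma log_ratio_Htilde (m l n A B L S2 T2 Lam d a b : R) :
  1 <= m -> 1 <= a -> 1 <= b -> 0 < l -> 0 < n -> m <= a * l -> m <= b * n ->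
  0 <= d <= 1 -> d * l = d * n -> A = n - d -> B = l - d -> n <= 2 * A -> l <= 2 * B ->
  L = l * A -> L = n * B ->
  0 <= S2 <= m * a -> 0 <= T2 <= m * b -> 0 <= Lam <= m * b ->
  a ^+ 2 * b ^+ 2 / m <= 1 / 300 ->
  `|log_ratio m l n A B L S2 T2 Lam d - log_Htilde m l n L S2 T2 Lam d|
     <= 24 * (a ^+ 2 * b ^+ 2 / m).
Proof.
move=> m1 a1 b1 l0 n0 mal mbn /andP[d0 d1] dln AE BE nA lB LA LB.
move=> /andP[S0 Sa] /andP[T0 Tb] /andP[La0 Lab] E1.
have m0 : 0 < m by lra.
have A0 : 0 < A by lra.
have B0 : 0 < B by lra.
have L0 : 0 < L by rewrite LA mulr_gt0.
pose x := m / l; pose y := m / n; pose e := m^-1.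
have e0 : 0 < e by rewrite invr_gt0.
have x0 : 0 < x by rewrite divr_gt0.
have y0 : 0 < y by rewrite divr_gt0.
have xa : x <= a by rewrite ler_pdivrMr.
have yb : y <= b by rewrite ler_pdivrMr.
set E := a ^+ 2 * b ^+ 2 / m in E1 *.
have ab1 : 1 <= a * b by rewrite -[leLHS]mul1r ler_pM.
have E_ge z : 0 <= z <= a ^+ 2 * b ^+ 2 -> z * e <= E.
  by move=> /andP[z0 zab]; rewrite /E ler_pM2r.
have Eab : a * b * e <= E.
  by apply: E_ge; rewrite mulr_ge0 ?(le_trans _ a1) ?(le_trans _ b1) //= -exprMn expr2 ler_peMl // (le_trans _ ab1).
pose u := S2 / m - x; pose v := T2 / m - y.
have Sm : 0 <= S2 / m <= a by rewrite divr_ge0 ?(ltW m0) //= ler_pdivrMr // mulrC.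
have Tm : 0 <= T2 / m <= b by rewrite divr_ge0 ?(ltW m0) //= ler_pdivrMr // mulrC.
have Lm : 0 <= Lam / m <= b by rewrite divr_ge0 ?(ltW m0) //= ler_pdivrMr // mulrC.
have ua : `|u| <= a by rewrite /u ler_norml; clear -Sm x0 xa; apply/andP; split; lra.
have vb : `|v| <= b by rewrite /v ler_norml; clear -Tm y0 yb; apply/andP; split; lra.
have nE : n^-1 = y * e by rewrite /y /e mulrAC mulfV ?gt_eqF // mul1r.
have lE : l^-1 = x * e by rewrite /x /e mulrAC mulfV ?gt_eqF // mul1r.
have iA : A^-1 <= 2 * (y * e).
  rewrite -nE; have -> : 2 * n^-1 = (n / 2)^-1 by field; rewrite gt_eqF.
  by rewrite lef_pV2 ?posrE //; clear -nA n0; lra.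
have iB : B^-1 <= 2 * (x * e).
  rewrite -lE; have -> : 2 * l^-1 = (l / 2)^-1 by field; rewrite gt_eqF.
  by rewrite lef_pV2 ?posrE //; clear -lB l0; lra.
have iA0 : 0 < A^-1 by rewrite invr_gt0.
have iB0 : 0 < B^-1 by rewrite invr_gt0.
pose mu := m / L.
have muE : mu = x * A^-1 by rewrite /mu /x LA; field; rewrite !gt_eqF.
have mu0 : 0 < mu by rewrite divr_gt0.
have xyab : x * y <= a * b by apply: ler_pM => //; exact: ltW.
have mu_le : mu <= 2 * (a * b * e).
  rewrite muE; apply: (@le_trans _ _ (x * (2 * (y * e)))); first by rewrite ler_pM2l.
  have -> : x * (2 * (y * e)) = 2 * (x * y * e) by ring.
  by apply: ler_wpM2l => //; apply: ler_wpM2r => //; exact: ltW.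
have mu_half : mu <= 1 / 2 by clear -mu_le Eab E1; lra.
have mu1 : 0 < 1 - mu by clear -mu_half; lra.
pose w := mu / (1 - mu).
have w0 : 0 <= w by rewrite divr_ge0 ?(ltW mu1) ?(ltW mu0).
have w_le : w <= 4 * (a * b * e).
  rewrite ler_pdivrMr //.
  have pos : 0 <= a * b * e * (1 - 2 * mu).
    by rewrite !mulr_ge0 ?(ltW e0) //; clear -a1 b1 mu_half; lra.
  by clear -mu_le pos; lra.
have kE : (1 - m / L)^-1 = 1 + w by rewrite -/mu /w; field; rewrite gt_eqF.
have w1 : w <= 1 by clear -w_le Eab E1; lra.
clearbody w.
have D2 : `|log_Htilde m l n L S2 T2 Lam d + (1 / 2) * (u * v) + d * (Lam / m - y)| <= 20 * E.
  have -> : log_Htilde m l n L S2 T2 Lam d + (1 / 2) * (u * v) + d * (Lam / m - y) =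
    - (1 / 2) * ((u + w * (1 + u)) * (v + w * (1 + v)) - u * v) - d * (Lam / m - y) * w.
    by rewrite /log_Htilde kE -/x -/y /u /v; ring.
  have h1 := perturbed_product ua vb a1 b1 (introT andP (conj w0 w1)).
  have {}h1 : `|(u + w * (1 + u)) * (v + w * (1 + v)) - u * v| <= 32 * E.
    apply: (le_trans h1).
    apply: (@le_trans _ _ (8 * (a * b) * (4 * (a * b * e)))).
      by rewrite ler_wpM2l // mulr_ge0 //; clear -ab1; lra.
    by have -> : 8 * (a * b) * (4 * (a * b * e)) = 32 * E by rewrite /E /e; ring.
  have h2 : `|d * (Lam / m - y) * w| <= 4 * E.
    rewrite !normrM (ger0_norm w0) (ger0_norm d0).
    apply: (@le_trans _ _ (1 * b * (4 * (a * b * e)))).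
      rewrite ler_pM ?mulr_ge0 // ler_pM //.
      by rewrite ler_norml; clear -Lm y0 yb; apply/andP; split; lra.
    rewrite mul1r mulrCA ler_pM2l // mulrA; apply: E_ge.
    apply/andP; split; first by rewrite !mulr_ge0 //; clear -a1 b1; lra.
    have -> : b * (a * b) = 1 * a * b ^+ 2 by ring.
    by rewrite expr2 ler_wpM2r ?sqr_ge0 // ler_wpM2r //; clear -a1; lra.
  apply: le_trans (ler_normB _ _) _; rewrite normrM.
  have -> : `|- (1 / 2) : R| = 1 / 2 by rewrite normrN ger0_norm // divr_ge0.
  by clear -h1 h2; lra.
have D1 : `|log_ratio m l n A B L S2 T2 Lam d + (1 / 2) * (u * v) + d * (Lam / m - y)| <= 4 * E.
  have dxy : d * x = d * y.
    have [->|dn0] := eqVneq d 0; first by rewrite !mul0r.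
    by rewrite /x /y (mulfI dn0 dln).
  have iAE : A^-1 = n^-1 + d * (n^-1 * A^-1) by rewrite AE in A0 *; field; rewrite !gt_eqF.
  have iBE : B^-1 = l^-1 + d * (l^-1 * B^-1) by rewrite BE in B0 *; field; rewrite !gt_eqF.
  have mE : m * e = 1 by rewrite /e mulfV ?gt_eqF.
  have -> : log_ratio m l n A B L S2 T2 Lam d + (1 / 2) * (u * v) + d * (Lam / m - y) =
      (S2 / m) * (d / 2 * y * A^-1) + (T2 / m) * (d / 2 * x * B^-1)
      + (mu / 2 - x * y * d / 2 * A^-1).
    have -> : log_ratio m l n A B L S2 T2 Lam d =
      - (1 / 2) * ((S2 / m) * (T2 / m)) - d * (Lam / m) - mu * (m - 1) / 2
      + S2 / m * (m * A^-1) / 2 + T2 / m * (m * B^-1) / 2 + d * x.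
      by rewrite /log_ratio /mu /x; field; rewrite !gt_eqF.
    rewrite dxy muE.
    have -> : m * B^-1 = x + d * x * B^-1 by rewrite {1}iBE /x; ring.
    have e1 : m * A^-1 = y + d * y * A^-1 by rewrite {1}iAE /y; ring.
    have -> : x * A^-1 * (m - 1) / 2 = (x * (m * A^-1) - x * A^-1) / 2 by ring.
    by rewrite e1 /u /v; field; rewrite !gt_eqF.
  have tri p q r p' q' r' : 0 <= p <= p' -> 0 <= q <= q' -> 0 <= r <= r' ->
      0 <= p * (d / 2 * q * r) <= p' * (1 / 2 * q' * r').
    move=> /andP[p0 pp] /andP[q0 qq] /andP[r0 rr].
    have d20 : 0 <= d / 2 by rewrite divr_ge0.
    rewrite !mulr_ge0 //= ler_pM ?mulr_ge0 // ler_pM ?mulr_ge0 // ler_pM //; clear -d1; lra.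
  have y_b : 0 <= y <= b by rewrite ltW.
  have x_a : 0 <= x <= a by rewrite ltW.
  have iA_b : 0 <= A^-1 <= 2 * (b * e).
    by rewrite (ltW iA0) (le_trans iA) // ler_pM2l // ler_pM2r.
  have iB_a : 0 <= B^-1 <= 2 * (a * e).
    by rewrite (ltW iB0) (le_trans iB) // ler_pM2l // ler_pM2r.
  have abb : a * b ^+ 2 * e <= E.
    apply: E_ge; rewrite mulr_ge0 ?sqr_ge0 //=; last by clear -a1 b1; lra.
    by rewrite ler_wpM2r ?sqr_ge0 // expr2 ler_peMl //; clear -a1 b1; lra.
  have aab : a ^+ 2 * b * e <= E.
    apply: E_ge; rewrite mulr_ge0 ?sqr_ge0 //=; last by clear -a1 b1; lra.
    by rewrite ler_wpM2l ?sqr_ge0 // expr2 ler_peMl //; clear -a1 b1; lra.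
  have /andP[h1 h1'] := tri _ _ _ _ _ _ Sm y_b iA_b.
  have /andP[h2 h2'] := tri _ _ _ _ _ _ Tm x_a iB_a.
  have /andP[h3 h3'] := tri _ _ _ _ _ _ x_a y_b iA_b.
  have e1 : a * (1 / 2 * b * (2 * (b * e))) = a * b ^+ 2 * e by field.
  have e2 : b * (1 / 2 * a * (2 * (a * e))) = a ^+ 2 * b * e by field.
  have e3 : x * y * d / 2 * A^-1 = x * (d / 2 * y * A^-1) by ring.
  rewrite e1 in h1' h3'; rewrite e2 in h2'; rewrite e3.
  by clear -h1 h1' h2 h2' h3 h3' abb aab mu0 mu_le Eab; rewrite ler_norml; apply/andP; split; lra.
have -> : log_ratio m l n A B L S2 T2 Lam d - log_Htilde m l n L S2 T2 Lam d =
  (log_ratio m l n A B L S2 T2 Lam d + (1 / 2) * (u * v) + d * (Lam / m - y)) -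
  (log_Htilde m l n L S2 T2 Lam d + (1 / 2) * (u * v) + d * (Lam / m - y)) by ring.
by apply: le_trans (ler_normB _ _) _; clear -D1 D2; lra.
Qed.
End Exponent.

(** * Ratio of the graph count to the binomial probability *)

Lemma sum_ord_le k (x : 'I_k -> nat) c : (forall i, x i <= c)%N -> (\sum_i x i <= c * k)%N.
Proof.
move=> xc; apply: leq_trans (leq_sum _ (fun i _ => xc i)) _.
by rewrite sum_nat_const card_ord mulnC.
Qed.

Lemma graph_count_ratio (R : realType) (l n m : nat) (del : bool)
    (U : 'I_l -> option 'I_n) (s : 'I_l -> nat) (t : 'I_n -> nat) (a b : nat) :
  (forall i j v, U i = Some v -> U j = Some v -> i = j) ->
  (forall i, ~~ del -> U i = None) -> (del -> l = n) ->
  (\sum_i s i = m)%N -> (\sum_v t v = m)%N ->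
  (forall i, s i <= a)%N -> (forall v, t v <= b)%N ->
  (0 < a)%N -> (0 < b)%N -> (0 < m)%N ->
  a%:R ^+ 2 * b%:R ^+ 2 / m%:R <= 1 / 300 :> R ->
  exists2 h : R, `|h| <= 140 * (a%:R ^+ 2 * b%:R ^+ 2 / m%:R) &
    #|graphs_of m (fun e => U e.1 != Some e.2) s t|%:R / 'C(l * (n - del), m)%:R =
    ('C(l * (n - del), m)%:R * 'C(n * (l - del), m)%:R)^-1 *
    (\prod_i 'C(n - del, s i)%:R * \prod_v 'C(l - del, t v)%:R) *
    expR (log_Htilde m%:R l%:R n%:R (l * (n - del))%:R
            (\sum_i s i * (s i).-1)%:R (\sum_v t v * (t v).-1)%:R
            (\sum_i s i * partner_deg U t i)%:R del%:R) * expR h.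
Proof.
move=> Uinj Unone hln sm tm sa tb a0 b0 m0 E1.
have mR : 0 < m%:R :> R by rewrite ltr0n.
have dR : 0 <= (del%:R : R) <= 1 by case: (del) => /=; lra.
have abm : (300 * (a * a * (b * b)) <= m)%N.
  rewrite -(ler_nat R) !natrM; move: E1; rewrite ler_pdivrMr //; lra.
have mal : (m <= a * l)%N by rewrite -sm sum_ord_le.
have mbn : (m <= b * n)%N by rewrite -tm sum_ord_le.
(* From 300 a^2 b^2 <= m <= b n. This room makes a small against n - del and n - del at least n / 2;
   [l_ge] does the same for b and l. *)
have n_ge : (300 * (a * a * b) <= n)%N.
  rewrite -(leq_pmul2l b0); apply: leq_trans mbn; apply: leq_trans abm.
  by rewrite mulnCA leq_mul2l -!mulnA (mulnCA b) (mulnCA b) leqnn orbT.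
have l_ge : (300 * (a * b * b) <= l)%N.
  rewrite -(leq_pmul2l a0); apply: leq_trans mal; apply: leq_trans abm.
  by rewrite mulnCA leq_mul2l -!mulnA leqnn orbT.
have ab_ge : (a <= a * a * b)%N by rewrite -mulnA leq_pmulr // muln_gt0 a0.
have ba_ge : (b <= a * b * b)%N by rewrite leq_pmull // muln_gt0 a0.
have del1 : (del <= 1)%N := leq_b1 del.
set A := (n - del)%N; set B := (l - del)%N.
have aA : (2 * a <= A)%N by rewrite /A; clear -n_ge ab_ge a0 del1; lia.
have bB : (2 * b <= B)%N by rewrite /B; clear -l_ge ba_ge b0 del1; lia.
have A0 : (0 < A)%N by apply: leq_trans aA; rewrite muln_gt0.
have B0 : (0 < B)%N by apply: leq_trans bB; rewrite muln_gt0.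
have n2A : (n <= 2 * A)%N by rewrite /A; clear -n_ge ab_ge a0 del1; lia.
have l2B : (l <= 2 * B)%N by rewrite /B; clear -l_ge ba_ge b0 del1; lia.
have deln : (del <= n)%N by clear -n_ge ab_ge a0 del1; lia.
have dell : (del <= l)%N by clear -l_ge ba_ge b0 del1; lia.
have n0 : (0 < n)%N by clear -n_ge ab_ge a0; lia.
have l0 : (0 < l)%N by clear -l_ge ba_ge b0; lia.
have half_le j k : (j <= 2 * k)%N -> j%:R / 2 <= k%:R :> R.
  by rewrite ler_pdivrMr // mulrC -natrM ler_nat.
have LE : (l * A = n * B)%N.
  by move: hln; rewrite /A /B; case: (del) => [->//|_]; rewrite !subn0 mulnC.
have LR : (2 * m <= l * A)%N.
  apply: leq_trans (_ : 2 * (a * l) <= _)%N; first by rewrite leq_mul2l.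
  by rewrite mulnA mulnC leq_mul2l aA orbT.
have ab8 : (8 * (a * b) <= m)%N.
  apply: leq_trans abm; apply: leq_mul => //; rewrite mulnACA leq_pmulr //.
  by rewrite muln_gt0 a0.
have [h1 hb1 E_N] := card_simple_graphs R Uinj sm tm sa tb a0 b0 ab8.
have [h2 hb2 E_A] := prod_ffact_expR R sm sa aA A0.
have [h3 hb3 E_B] := prod_ffact_expR R tm tb bB B0.
have L0 : (0 < l * A)%N by rewrite muln_gt0 l0.
have [h4 hb4 E_L] := ffact_expR R LR L0.
have lR : 0 < l%:R :> R by rewrite ltr0n.
have nR : 0 < n%:R :> R by rewrite ltr0n.
have AR : 0 < A%:R :> R by rewrite ltr0n.
have BR : 0 < B%:R :> R by rewrite ltr0n.
have AE : A%:R = n%:R - del%:R :> R by rewrite natrB.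
have BE : B%:R = l%:R - del%:R :> R by rewrite natrB.
set S2 := (\sum_i s i * (s i).-1)%N in E_N E_A *.
set T2 := (\sum_v t v * (t v).-1)%N in E_N E_B *.
set Lam := (\sum_i s i * partner_deg U t i)%N in E_N *.
set N := #|graphs_of _ _ _ _| in E_N *.
set E := a%:R ^+ 2 * b%:R ^+ 2 / m%:R in E1 *.
have x_a : m%:R / l%:R <= a%:R :> R by rewrite ler_pdivrMr // -natrM ler_nat.
have y_b : m%:R / n%:R <= b%:R :> R by rewrite ler_pdivrMr // -natrM ler_nat.
have x0 : 0 <= m%:R / l%:R :> R by rewrite divr_ge0.
have y0 : 0 <= m%:R / n%:R :> R by rewrite divr_ge0.
have aR1 : 1 <= a%:R :> R by rewrite ler1n.
have bR1 : 1 <= b%:R :> R by rewrite ler1n.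
have EE z : z <= a%:R ^+ 2 * b%:R ^+ 2 -> z / m%:R <= E.
  by move=> hz; rewrite /E ler_pM2r // invr_gt0.
(* The factor (1 - del/l)^m compares (l A)^m with (A B)^m. *)
pose q : R := del%:R / l%:R.
have q0 : 0 <= q by rewrite divr_ge0.
have qh : q <= 1 / 2.
  by rewrite ler_pdivrMr //; have := half_le _ _ l2B; rewrite BE; clear; lra.
have q1 : 0 < 1 - q by clear -qh; lra.
pose eta := ln (1 - q) + q.
have eta_b : `|eta| <= 2 * q ^+ 2 by apply: ln_1B_bound; rewrite q0 qh.
have E_l : l%:R ^+ m = B%:R ^+ m * expR (m%:R * (q - eta)) :> R.
  rewrite expRM_natl -exprMn; congr (_ ^+ _).
  have -> : q - eta = - ln (1 - q) by rewrite /eta; ring.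
  rewrite expRN lnK ?posrE //.
  have -> : B%:R = l%:R * (1 - q) :> R.
    by rewrite BE mulrBr mulr1 /q mulrCA mulfV ?gt_eqF // mulr1.
  by rewrite mulfK // gt_eqF.
have eta_E : `|m%:R * eta| <= 2 * E.
  rewrite normrM (ger0_norm (ltW mR)).
  apply: (@le_trans _ _ (m%:R * (2 * (1 / l%:R) ^+ 2))).
    rewrite ler_pM2l // (le_trans eta_b) // ler_pM2l // lerXn2r ?nnegrE ?divr_ge0 //.
    by rewrite ler_pM2r ?invr_gt0 //; case/andP: dR.
  have -> : m%:R * (2 * (1 / l%:R) ^+ 2) = 2 * ((m%:R / l%:R) ^+ 2 / m%:R) :> R.
    by field; rewrite !gt_eqF.
  rewrite ler_pM2l //; apply: EE; rewrite -[leLHS]mulr1 ler_pM ?sqr_ge0 //.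
    by rewrite lerXn2r ?nnegrE.
  by rewrite exprn_ege1.
have hb2' : `|h2| <= 8 * E.
  apply: le_trans hb2 _.
  apply: (@le_trans _ _ (2 * (m%:R * a%:R ^+ 2 / (n%:R / 2) ^+ 2))).
    rewrite ler_pM2l // ler_wpM2l ?mulr_ge0 ?exprn_ge0 // lef_pV2 ?posrE ?exprn_gt0 ?divr_gt0 //.
    by rewrite lerXn2r ?nnegrE ?divr_ge0 // half_le.
  have -> : 2 * (m%:R * a%:R ^+ 2 / (n%:R / 2) ^+ 2) =
      8 * (a%:R ^+ 2 * (m%:R / n%:R) ^+ 2 / m%:R) :> R by field; rewrite !gt_eqF.
  rewrite ler_pM2l //; apply: EE; rewrite ler_pM2l ?exprn_gt0 ?ltr0n //.
  by rewrite lerXn2r ?nnegrE.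
have hb3' : `|h3| <= 8 * E.
  apply: le_trans hb3 _.
  apply: (@le_trans _ _ (2 * (m%:R * b%:R ^+ 2 / (l%:R / 2) ^+ 2))).
    rewrite ler_pM2l // ler_wpM2l ?mulr_ge0 ?exprn_ge0 // lef_pV2 ?posrE ?exprn_gt0 ?divr_gt0 //.
    by rewrite lerXn2r ?nnegrE ?divr_ge0 // half_le.
  have -> : 2 * (m%:R * b%:R ^+ 2 / (l%:R / 2) ^+ 2) =
      8 * ((m%:R / l%:R) ^+ 2 * b%:R ^+ 2 / m%:R) :> R by field; rewrite !gt_eqF.
  rewrite ler_pM2l //; apply: EE; rewrite ler_pM2r ?exprn_gt0 ?ltr0n //.
  by rewrite lerXn2r ?nnegrE.
have hb4' : `|h4| <= 8 * E.
  apply: le_trans hb4 _.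
  apply: (@le_trans _ _ (2 * (m%:R * m%:R ^+ 2 / (l%:R * (n%:R / 2)) ^+ 2))).
    rewrite ler_pM2l // ler_wpM2l ?mulr_ge0 ?exprn_ge0 //.
    rewrite lef_pV2 ?posrE ?exprn_gt0 ?mulr_gt0 ?divr_gt0 ?ltr0n //.
    by rewrite lerXn2r ?nnegrE ?mulr_ge0 ?divr_ge0 // natrM ler_pM2l // half_le.
  have -> : 2 * (m%:R * m%:R ^+ 2 / (l%:R * (n%:R / 2)) ^+ 2) =
      8 * ((m%:R / l%:R) ^+ 2 * (m%:R / n%:R) ^+ 2 / m%:R) :> R by field; rewrite !gt_eqF.
  rewrite ler_pM2l //; apply: EE; rewrite ler_pM ?sqr_ge0 //; by rewrite lerXn2r ?nnegrE.
have sum_sq k (x : 'I_k -> nat) c : (\sum_i x i = m)%N -> (forall i, x i <= c)%N ->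
    0 <= ((\sum_i x i * (x i).-1)%N%:R : R) <= m%:R * c%:R.
  move=> xm xc; rewrite ler0n /= -natrM ler_nat -xm big_distrl leq_sum // => i _.
  by rewrite leq_mul2l (leq_trans (leq_pred _)) ?orbT.
have Lam_b : 0 <= (Lam%:R : R) <= m%:R * b%:R.
  rewrite ler0n /= -natrM ler_nat -sm big_distrl leq_sum // => i _.
  by rewrite leq_mul2l /partner_deg; case: (U i) => [v|]; rewrite ?tb ?orbT.
have LamE : del%:R * Lam%:R = Lam%:R :> R.
  case: (boolP del) => [_|nd]; first by rewrite mul1r.
  by rewrite /Lam big1 ?mulr0 // => i _; rewrite /partner_deg Unone ?muln0.
have dln : del%:R * l%:R = del%:R * n%:R :> R.
  by move: hln; case: (del) => [->//|_]; rewrite !mul0r.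
have := @log_ratio_Htilde R m%:R l%:R n%:R A%:R B%:R (l * A)%:R S2%:R T2%:R Lam%:R
  del%:R a%:R b%:R; set lr := log_ratio _ _ _ _ _ _ _ _ _ _; set lH := log_Htilde _ _ _ _ _ _ _ _.
move=> /(_ _ aR1 bR1 lR nR) hlr.
have {}hlr : `|lr - lH| <= 24 * E.
  by apply: hlr => //; [rewrite ler1n|rewrite -natrM ler_nat|rewrite -natrM ler_nat
    |rewrite -natrM ler_nat|rewrite -natrM ler_nat|rewrite natrM|rewrite LE natrM
    |exact: sum_sq|exact: sum_sq].
(* The bounds add up to 80 + 8 + 2 + 8 + 8 + 24 = 130 times E. *)
exists (h1 + h4 - m%:R * eta - h2 - h3 + (lr - lH)).
  have := ler_normD (h1 + h4 - m%:R * eta - h2 - h3) (lr - lH).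
  have := ler_normB (h1 + h4 - m%:R * eta - h2) h3.
  have := ler_normB (h1 + h4 - m%:R * eta) h2.
  have := ler_normB (h1 + h4) (m%:R * eta).
  have := ler_normD h1 h4.
  have E0 : 0 <= E by rewrite divr_ge0 ?mulr_ge0 ?sqr_ge0.
  rewrite -/E in hb1; clear -hb1 hb2' hb3' hb4' eta_E hlr E0; lra.
pose C : R := 'C(l * A, m)%:R.
pose CA : R := \prod_i 'C(A, s i)%:R; pose CB : R := \prod_v 'C(B, t v)%:R.
pose P : R := \prod_i (s i)`!%:R; pose Q : R := \prod_v (t v)`!%:R.
have fact_neq0 k : k`!%:R != 0 :> R by rewrite pnatr_eq0 -lt0n fact_gt0.
have P0 : P != 0 by apply/prodf_neq0 => i _.
have Q0 : Q != 0 by apply/prodf_neq0 => i _.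
have {}E_A : CA * P = A%:R ^+ m * expR (h2 - S2%:R / (2 * A%:R)).
  by rewrite -E_A -big_split; apply: eq_bigr => i _ /=; rewrite -natrM bin_ffact.
have {}E_B : CB * Q = B%:R ^+ m * expR (h3 - T2%:R / (2 * B%:R)).
  by rewrite -E_B -big_split; apply: eq_bigr => i _ /=; rewrite -natrM bin_ffact.
have {}E_L : C * m`!%:R = (l * A)%:R ^+ m * expR (h4 - (m * m.-1)%:R / (2 * (l * A)%:R)).
  by rewrite -E_L -natrM bin_ffact.
rewrite -/P -/Q in E_N.
have C0 : C != 0.
  rewrite pnatr_eq0 -lt0n bin_gt0; apply: leq_trans LR; by rewrite leq_pmull.
rewrite -LE -/C -/CA -/CB; set h := (X in _ = _ * expR X).
(* The graph model divides by C once and the binomial model twice, so one factor C survives in the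
   ratio. *)
suff NC : N%:R * C = CA * CB * expR lH * expR h.
  have -> : N%:R / C = N%:R * C / (C * C) by field.
  by rewrite NC; field.
(* Multiplying by these factorials turns every binomial coefficient into a falling factorial, and
   the graph count into the form of [card_simple_graphs]. *)
have nz : P * Q * m`!%:R != 0 by rewrite !mulf_neq0.
apply: (mulIf nz).
have -> : N%:R * C * (P * Q * m`!%:R) = (N%:R * (P * Q)) * (C * m`!%:R) by ring.
have -> : CA * CB * expR lH * expR h * (P * Q * m`!%:R) =
  (CA * P) * (CB * Q) * m`!%:R * (expR lH * expR h) by ring.
rewrite E_N E_A E_B E_L natrM exprMn E_l -expRD.
set X := expR (_ + h); transitivity (m`!%:R * A%:R ^+ m * B%:R ^+ m *
  (expR (h1 - S2%:R * T2%:R / (2 * m%:R ^+ 2) - Lam%:R / m%:R) * expR (m%:R * (q - eta)) *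
   expR (h4 - (m * m.-1)%:R / (2 * (l%:R * A%:R))))); first by ring.
transitivity (m`!%:R * A%:R ^+ m * B%:R ^+ m *
  (expR (h2 - S2%:R / (2 * A%:R)) * expR (h3 - T2%:R / (2 * B%:R)) * X)); last by ring.
congr (_ * _); rewrite /X -!expRD; congr expR.
have mm : (m * m.-1)%:R = m%:R * (m%:R - 1) :> R by rewrite natrM -subn1 natrB.
rewrite mm /h /lr /log_ratio /q natrM mulNr LamE; ring.
Qed.

(** * The two random graph models *)

Lemma card_bip_graphs l n m : #|bip_graphs l n m| = 'C(l * n, m).
Proof. by rewrite card_draws card_prod !card_ord. Qed.

Lemma card_di_graphs n m : #|di_graphs n m| = 'C(n * n.-1, m).
Proof.
pose B := [set e : 'I_n * 'I_n | e.1 != e.2].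
have cB : #|B| = (n * n.-1)%N.
  rewrite -sum1dep_card -(pair_big_dep xpredT (fun i j : 'I_n => i != j) (fun _ _ => 1%N)) /=.
  rewrite (eq_bigr (fun=> n.-1)); first by rewrite sum_nat_const card_ord.
  move=> i _; rewrite sum1dep_card cardsE -[in RHS](card_ord n) -(cardC1 i).
  by apply: eq_card => j; rewrite !inE eq_sym.
rewrite -cB -cards_draws; apply: eq_card => G; rewrite !inE andbC; congr (_ && _).
apply/forallP/subsetP => [h [i j] eG|h i].
  by rewrite inE /=; apply: contraTneq eG => /= ->; exact: h.
by apply/negP => /h; rewrite inE eqxx.
Qed.

(** Bridges the classical comprehension in [degrees] and the finite set in [graphs_of]. *)
Lemma card_classical_set (I : finType) (P : pred I) :
  #|[set v | P v]%classic| = #|[set v | P v]|.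
Proof. by apply: eq_card => v; rewrite [RHS]inE; apply/idP/idP => [/set_mem|/mem_set]. Qed.

Lemma degreesE l n (G : bigraph l n) (d : degseq l n) : (degrees G == d) =
  [forall a, #|[set v | (a, v) \in G]| == d.1 a] &&
  [forall v, #|[set a | (a, v) \in G]| == d.2 v].
Proof.
case: d => d1 d2; apply/eqP/andP => [[<- <-]|[/forallP h1 /forallP h2]].
  by split; apply/forallP => a; rewrite ffunE card_classical_set.
congr pair; apply/ffunP => a; rewrite ffunE card_classical_set; apply/eqP.
  exact: h1.
exact: h2.
Qed.

Lemma bip_graphs_of l n m (d : degseq l n) :
  #|[set G in bip_graphs l n m | degrees G == d]| =
  #|graphs_of m (fun e => (fun=> None) e.1 != Some e.2) d.1 d.2|.
Proof.
apply: eq_card => G; rewrite !inE degreesE; congr (_ && _).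
by rewrite (_ : [forall e in G, _]) //; apply/forall_inP.
Qed.

Lemma di_graphs_of n m (d : degseq n n) :
  #|[set G in di_graphs n m | degrees G == d]| =
  #|graphs_of m (fun e => Some e.1 != Some e.2) d.1 d.2|.
Proof.
apply: eq_card => G; rewrite !inE degreesE -andbA; congr [&& _, _ & _].
apply/forallP/forall_inP => [h [i j] eG|h i].
  by apply: contraTneq eG => -[->]; exact: h.
by apply/negP => /h /=; rewrite eqxx.
Qed.

(** * The correction factor in terms of factorial moments *)

Section Htilde.
Variable R : realType.

Lemma variance_aboutE k m (x : {ffun 'I_k -> nat}) : (\sum_i x i = m)%N -> (0 < m)%N ->
  variance_about (m%:R / k%:R : R) x / (m%:R / k%:R) =
  1 + (\sum_i x i * (x i).-1)%N%:R / m%:R - m%:R / k%:R.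
Proof.
move=> xm m0; have mR : m%:R != 0 :> R by rewrite pnatr_eq0 -lt0n.
have kR : k%:R != 0 :> R.
  rewrite pnatr_eq0; apply: contraTneq m0 => k0.
  by rewrite -xm big1 // => i; move: (ltn_ord i); rewrite [X in (_ < X)%N]k0.
rewrite /variance_about; set c := m%:R / k%:R.
have -> : \sum_(i < k) ((x i)%:R - c) ^+ 2 =
    (\sum_i x i * (x i).-1)%N%:R + m%:R - 2 * c * m%:R + k%:R * c ^+ 2.
  have sq i : ((x i)%:R - c) ^+ 2 = (x i * (x i).-1)%N%:R + (x i)%:R - 2 * c * (x i)%:R + c ^+ 2.
    have -> : (x i * (x i).-1)%N%:R = (x i)%:R * ((x i)%:R - 1) :> R.
      by rewrite natrM; case: (x i) => [|y]; rewrite ?mul0r // -natr1 addrK.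
    by ring.
  rewrite (eq_bigr _ (fun i _ => sq i)) !big_split /= sumrN -mulr_sumr -!natr_sum xm.
  by rewrite sumr_const card_ord -[c ^+ 2 *+ k]mulr_natl.
by rewrite /c; field; rewrite mR kR.
Qed.

Lemma Htilde_bipE l n m (d : degseq l n) : sums_to m d -> (0 < m)%N ->
  Htilde_bip R m d = expR (log_Htilde m%:R l%:R n%:R (l * n)%:R
    (\sum_i d.1 i * (d.1 i).-1)%N%:R (\sum_v d.2 v * (d.2 v).-1)%N%:R 0 0).
Proof.
move=> /andP[/eqP sm /eqP tm] m0; rewrite /Htilde_bip /log_Htilde; congr expR.
have e k (c w : R) (x : {ffun 'I_k -> nat}) :
  variance_about c x / (c * w) = variance_about c x / c * w^-1 by rewrite invfM mulrA.
by rewrite /= !e !variance_aboutE // -natrM [(n * l)%N]mulnC !mul0r subr0.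
Qed.

Lemma Htilde_diE n m (d : degseq n n) : sums_to m d -> (0 < m)%N ->
  Htilde_di R m d = expR (log_Htilde m%:R n%:R n%:R (n * n.-1)%:R
    (\sum_i d.1 i * (d.1 i).-1)%N%:R (\sum_v d.2 v * (d.2 v).-1)%N%:R
    (\sum_i d.1 i * d.2 i)%N%:R 1).
Proof.
move=> /andP[/eqP sm /eqP tm] m0; rewrite /Htilde_di /log_Htilde; congr expR.
have n0 : (0 < n)%N.
  case: n d sm {tm} => // d; rewrite big_ord0 => e; by rewrite -e in m0.
have mR : m%:R != 0 :> R by rewrite pnatr_eq0 -lt0n.
have nR : n%:R != 0 :> R by rewrite pnatr_eq0 -lt0n.
have n1 : n%:R - 1 = n.-1%:R :> R by rewrite -subn1 natrB.
have e k (c w : R) (x : {ffun 'I_k -> nat}) :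
  variance_about c x / (c * w) = variance_about c x / c * w^-1 by rewrite invfM mulrA.
rewrite /= !e !variance_aboutE // n1 -natrM mul1r [in X in _ - X = _]invfM mulrA; congr (_ - _ * _).
set c := m%:R / n%:R.
have -> : \sum_(a < n) ((d.1 a)%:R - c) * ((d.2 a)%:R - c) =
    (\sum_i d.1 i * d.2 i)%N%:R - 2 * c * m%:R + n%:R * c ^+ 2.
  have sq i : ((d.1 i)%:R - c) * ((d.2 i)%:R - c) =
      (d.1 i * d.2 i)%N%:R - c * (d.1 i)%:R - c * (d.2 i)%:R + c ^+ 2.
    by rewrite natrM; ring.
  have s1 : \sum_i c * (d.1 i)%:R = c * m%:R by rewrite -mulr_sumr -natr_sum sm.
  have s2 : \sum_i c * (d.2 i)%:R = c * m%:R by rewrite -mulr_sumr -natr_sum tm.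
  rewrite (eq_bigr _ (fun i _ => sq i)) !big_split /= !sumrN s1 s2 -natr_sum.
  by rewrite sumr_const card_ord -[c ^+ 2 *+ n]mulr_natl; ring.
by rewrite /c; field; rewrite mR nR.
Qed.
End Htilde.

(** * Consequences of the degree hypotheses *)

Section Degrees.
Variables (R : realType) (l n m : nat) (d : degseq l n).
Hypotheses (hd : sums_to m d) (m0 : (0 < m)%N).
Local Notation a := (DeltaS d).
Local Notation b := (DeltaT d).

Lemma le_DeltaS i : (d.1 i <= a)%N.
Proof. exact: (leq_bigmax (F := fun i => d.1 i)). Qed.

Lemma le_DeltaT v : (d.2 v <= b)%N.
Proof. exact: (leq_bigmax (F := fun v => d.2 v)). Qed.

Lemma sumS_le : (m <= a * l)%N.
Proof. by have /andP[/eqP <- _] := hd; apply: sum_ord_le; exact: le_DeltaS. Qed.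

Lemma sumT_le : (m <= b * n)%N.
Proof. by have /andP[_ /eqP <-] := hd; apply: sum_ord_le; exact: le_DeltaT. Qed.

Lemma DeltaS_gt0 : (0 < a)%N.
Proof. by have := leq_trans m0 sumS_le; rewrite muln_gt0 => /andP[]. Qed.

Lemma DeltaT_gt0 : (0 < b)%N.
Proof. by have := leq_trans m0 sumT_le; rewrite muln_gt0 => /andP[]. Qed.

Lemma l_gt0 : (0 < l)%N.
Proof. by have := leq_trans m0 sumS_le; rewrite muln_gt0 => /andP[]. Qed.

Lemma n_gt0 : (0 < n)%N.
Proof. by have := leq_trans m0 sumT_le; rewrite muln_gt0 => /andP[]. Qed.

Lemma Delta_term_ge (eps : R) : 0 < eps ->
  a%:R ^+ 3 * b%:R ^+ 3 <= Delta_term eps d.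
Proof.
move=> eps0; rewrite /Delta_term ler_peMr ?mulr_ge0 ?exprn_ge0 //.
rewrite -[leLHS](powRr0 (n%:R * l%:R)) ler_powR //; last by rewrite divr_ge0 // ltW.
by rewrite -natrM ler1n muln_gt0 n_gt0 l_gt0.
Qed.

(** The hypothesis gives a^3 b^3 <= s m / 300, and the average s is at most the maximum a;
    cancelling a leaves a^2 b^3 <= m / 300. *)
Lemma small_degrees (eps : R) : 0 < eps ->
  let s : R := m%:R / l%:R in let t : R := m%:R / n%:R in
  `|Delta_term eps d| <= 1 / 300 * `|Num.min (s * m%:R) (t * m%:R)| ->
  a%:R ^+ 2 * b%:R ^+ 2 / m%:R <= 1 / 300 :> R.
Proof.
move=> eps0 s t.
have aR : 0 < a%:R :> R by rewrite ltr0n DeltaS_gt0.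
have bR : 1 <= b%:R :> R by rewrite ler1n DeltaT_gt0.
have mR : 0 < m%:R :> R by rewrite ltr0n.
have lR : 0 < l%:R :> R by rewrite ltr0n l_gt0.
have s0 : 0 <= s by rewrite divr_ge0.
have t0 : 0 <= t by rewrite divr_ge0.
have b0 : 0 < b%:R :> R by lra.
rewrite [X in _ * X]ger0_norm; last by rewrite le_min !mulr_ge0 // ltW.
move=> h; have {h} h : a%:R ^+ 3 * b%:R ^+ 3 <= 1 / 300 * (s * m%:R).
  apply: le_trans (Delta_term_ge eps0) _; apply: le_trans (ler_norm _) _.
  by apply: le_trans h _; rewrite ler_wpM2l ?divr_ge0 // ge_min lexx.
have sa : s <= a%:R by rewrite ler_pdivrMr // -natrM ler_nat sumS_le.
rewrite ler_pdivrMr // -(ler_pM2l aR); apply: le_trans (_ : a%:R ^+ 3 * b%:R ^+ 3 <= _).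
  have -> : a%:R ^+ 3 * b%:R ^+ 3 = a%:R * (a%:R ^+ 2 * (b%:R ^+ 2 * b%:R)) :> R by ring.
  by rewrite ler_pM2l // ler_wpM2l ?sqr_ge0 // ler_peMr ?sqr_ge0.
apply: le_trans h _; rewrite [leRHS]mulrCA ler_pM2l ?divr_gt0 //.
by rewrite ler_wpM2r // ltW.
Qed.

(** As s <= a, the summand with 1/s is at least a^3 b^3 / (m a) = a^2 b^3 / m. *)
Lemma error_term_ge (eps : R) : 0 < eps ->
  a%:R ^+ 2 * b%:R ^+ 2 / m%:R <= error_term eps m d.
Proof.
move=> eps0; rewrite /error_term.
set s : R := m%:R / l%:R; set t : R := m%:R / n%:R.
have aR : 0 < a%:R :> R by rewrite ltr0n DeltaS_gt0.
have bR : 1 <= b%:R :> R by rewrite ler1n DeltaT_gt0.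
have mR : 0 < m%:R :> R by rewrite ltr0n.
have lR : 0 < l%:R :> R by rewrite ltr0n l_gt0.
have s0 : 0 < s by rewrite divr_gt0.
have sa : s <= a%:R by rewrite ler_pdivrMr // -natrM ler_nat sumS_le.
have t0 : 0 <= t^-1 by rewrite invr_ge0 divr_ge0.
have h := Delta_term_ge eps0.
rewrite -addrA ler_wpDr ?addr_ge0 ?powR_ge0 //.
apply: (@le_trans _ _ (a%:R ^+ 3 * b%:R ^+ 3 / m%:R * a%:R^-1)).
  have -> : a%:R ^+ 3 * b%:R ^+ 3 / m%:R * a%:R^-1 =
      a%:R ^+ 2 * (b%:R ^+ 2 * b%:R) / m%:R :> R by field; rewrite !gt_eqF.
  by rewrite ler_pM2r ?invr_gt0 // ler_wpM2l ?sqr_ge0 // ler_peMr ?sqr_ge0.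
have D0 : 0 <= Delta_term eps d by apply: le_trans h; rewrite mulr_ge0 ?exprn_ge0.
apply: ler_pM; rewrite ?invr_ge0 ?divr_ge0 ?mulr_ge0 ?exprn_ge0 ?(ltW aR) //.
  by rewrite ler_pM2r ?invr_gt0.
by apply: ler_wpDr => //; rewrite lef_pV2 ?posrE.
Qed.
End Degrees.

(** * Specialization to bipartite graphs and digraphs *)

Lemma prob_bip_ratio (R : realType) (l n m : nat) (p : R) (d : degseq l n) :
  0 < p < 1 -> sums_to m d -> (0 < m)%N ->
  (DeltaS d)%:R ^+ 2 * (DeltaT d)%:R ^+ 2 / m%:R <= 1 / 300 :> R ->
  exists2 h : R, `|h| <= 140 * ((DeltaS d)%:R ^+ 2 * (DeltaT d)%:R ^+ 2 / m%:R) &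
    prob_degrees R (bip_graphs l n m) d =
    prob_bip_Bm m p d * Htilde_bip R m d * expR h.
Proof.
move=> p01 hd m0 hE; have /andP[/eqP sm /eqP tm] := hd.
have [|//|//|h hb hP] := @graph_count_ratio R l n m false (fun=> None) d.1 d.2
  (DeltaS d) (DeltaT d) _ _ _ sm tm (le_DeltaS d) (le_DeltaT d)
  (DeltaS_gt0 hd m0) (DeltaT_gt0 hd m0) m0 hE; first by [].
exists h => //; rewrite /prob_degrees bip_graphs_of card_bip_graphs.
rewrite /prob_bip_Bm prob_BmE // Htilde_bipE //; move: hP; rewrite !subn0 => ->.
rewrite (_ : (\sum_i d.1 i * partner_deg _ _ i)%N = 0%N) //.
by rewrite big1 // => i _; rewrite muln0.
Qed.

Lemma prob_di_ratio (R : realType) (n m : nat) (p : R) (d : degseq n n) :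
  0 < p < 1 -> sums_to m d -> (0 < m)%N ->
  (DeltaS d)%:R ^+ 2 * (DeltaT d)%:R ^+ 2 / m%:R <= 1 / 300 :> R ->
  exists2 h : R, `|h| <= 140 * ((DeltaS d)%:R ^+ 2 * (DeltaT d)%:R ^+ 2 / m%:R) &
    prob_degrees R (di_graphs n m) d =
    prob_di_Bm m p d * Htilde_di R m d * expR h.
Proof.
move=> p01 hd m0 hE; have /andP[/eqP sm /eqP tm] := hd.
have [|//|//|h hb hP] := @graph_count_ratio R n n m true Some d.1 d.2
  (DeltaS d) (DeltaT d) _ _ _ sm tm (le_DeltaS d) (le_DeltaT d)
  (DeltaS_gt0 hd m0) (DeltaT_gt0 hd m0) m0 hE; first by move=> i j v [->] [->].
exists h => //; rewrite /prob_degrees di_graphs_of card_di_graphs.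
by rewrite /prob_di_Bm prob_BmE // Htilde_diE //; move: hP; rewrite !subn1.
Qed.

Local Open Scope classical_set_scope.

Theorem theorem1p3 (R : realType) (eps : R) (heps0 : 0 < eps) (heps1 : eps < 1 / 2)
    (m : nat -> nat) (p : nat -> R) (hp : forall n, 0 < p n < 1) :
  (forall (l : nat -> nat) (D : forall n, set (degseq (l n) n)),
     admissible eps l m D ->
     uniform_eq_1pO D
       (fun n d => prob_degrees R (bip_graphs (l n) n (m n)) d)
       (fun n d => prob_bip_Bm (m n) (p n) d * Htilde_bip R (m n) d)
       (fun n d => error_term eps (m n) d))
  /\
  (forall D : forall n, set (degseq n n),
     admissible eps (fun n => n) m D ->
     uniform_eq_1pO D
       (fun n d => prob_degrees R (di_graphs n (m n)) d)
       (fun n d => prob_di_Bm (m n) (p n) d * Htilde_di R (m n) d)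
       (fun n d => error_term eps (m n) d)).
Proof.
(* From E <= 1/300, |h| <= 140/300 < 1/2, so exp h - 1 is at most 2 |h| <= 280 E in absolute value.
   This fixes both the level 1/300 at which the o-hypothesis is used and the final constant 280. *)
have theta_bound (E er h : R) : E <= 1 / 300 -> E <= er -> `|h| <= 140 * E ->
    `|expR h - 1| <= 280 * `|er|.
  move=> E1 E2 hb; apply: le_trans (expRB1_bound _) _; first by lra.
  by have := ler_norm er; lra.
split=> [l D [_ hD]|D [_ hD]] /(_ (1 / 300)) small; exists 280;
  (have := small _; rewrite divr_gt0 // => /(_ isT); apply: filterS => n hn d Dd);
  have [hd m0] := hD n d Dd; have hE := small_degrees hd m0 heps0 (hn d Dd);
  have hr := error_term_ge hd m0 heps0.
- have [h hb ->] := prob_bip_ratio (hp n) hd m0 hE.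
  exists (expR h - 1); first exact: theta_bound hE hr hb.
  by rewrite addrC subrK.
- have [h hb ->] := prob_di_ratio (hp n) hd m0 hE.
  exists (expR h - 1); first exact: theta_bound hE hr hb.
  by rewrite addrC subrK.
Qed.
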